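(* Fix an integer $d\ge 1$ and a constant $c\in\mathbb{N}$. The $c$-th moment of the smoothed number of Pareto-optimal solutions is $O\big((n^{2d}\phi^d)^c\big)$ for quasiconcave $\phi$-smooth instances and $O\big((n^{2d}\phi^{d(d+1)})^c\big)$ for general $\phi$-smooth instances, where the constants hidden in the $O$-notation depend only on $d$ and $c$.
   Context: Multiobjective binary optimization model: an instance consists of $\mathcal{S}\subseteq\{0,1\}^n$ and $d+1$ objectives to be minimized: an arbitrary $V^{d+1}\colon\mathcal{S}\to\mathbb{R}$ and linear $V^t(x)=\sum_{i=1}^n V^t_i x_i$, $t\in[d]$. A solution $x\in\mathcal{S}$ is Pareto-optimal if no $y\in\mathcal{S}$ satisfies $V^t(y)\le V^t(x)$ for all $t\in[d+1]$ with strict inequality for some $t$; $\mathrm{PO}(V)$ is the number of Pareto-optimal solutions for the coefficient matrix $V=(V^t_i)\in\mathbb{R}^{d\times n}$. $\phi$-smooth instances ($\phi\ge1$): an adversary chooses $\mathcal{S}$, $V^{d+1}$, and for each coefficient $V^t_i$ a density $f^t_i\colon[-1,1]\to[0,\phi]$; each $V^t_i$ is drawn independently according to $f^t_i$. In quasiconcave $\phi$-smooth instances each $f^t_i$ is additionally quasiconcave: there is $x^t_i\in[-1,1]$ such that $f^t_i$ is non-decreasing on $[-1,x^t_i]$ and non-increasing on $[x^t_i,1]$. The $c$-th moment of the smoothed number of Pareto-optimal solutions is the supremum over all adversarial choices (of the respective kind) of $\mathbb{E}_V[\mathrm{PO}(V)^c]$. *)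

(* Defs.v *)
From HB Require Import structures.
From mathcomp Require Import all_boot all_order all_algebra.
From mathcomp Require Import all_classical all_reals all_analysis.

Set Implicit Arguments.
Unset Strict Implicit.
Unset Printing Implicit Defensive.

Import Order.TTheory GRing.Theory Num.Theory.
Import numFieldNormedType.Exports.

Local Open Scope classical_set_scope.
Local Open Scope ring_scope.

Notation cube n := {ffun 'I_n -> bool}.

(* The d linear objectives come first; the last index, ord_max, is the
   arbitrary objective W. Only the values of W on the feasible set matter. *)
Definition objective (R : realType) (d n : nat) (W : cube n -> R)
    (V : 'M[R]_(d, n)) (t : 'I_d.+1) (x : cube n) : R :=
  if unlift ord_max t is Some s then \sum_(i < n) V s i * (x i)%:R else W x.

Definition dominates (R : realType) (d n : nat) (W : cube n -> R)
    (V : 'M[R]_(d, n)) (y x : cube n) : bool :=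
  [forall t, objective W V t y <= objective W V t x] &&
  [exists t, objective W V t y < objective W V t x].

Definition pareto_optimal (R : realType) (d n : nat) (S : {set cube n})
    (W : cube n -> R) (V : 'M[R]_(d, n)) : {set cube n} :=
  [set x in S | ~~ [exists y in S, dominates W V y x]]%SET.

Definition PO (R : realType) (d n : nat) (S : {set cube n}) (W : cube n -> R)
    (V : 'M[R]_(d, n)) : nat :=
  #|pareto_optimal S W V|.

(* A density on [-1, 1] is a total function whose values outside [-1, 1] are
   ignored. *)
Definition smooth_density (R : realType) (phi : R) (f : R -> R) : Prop :=
  [/\ measurable_fun `[-1 : R, 1] f,
      forall x, x \in `[-1, 1] -> 0 <= f x <= phi &
      (\int[lebesgue_measure]_(x in `[(-1 : R)%R, 1%R]) (f x)%:E = 1)%E].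

Definition quasiconcave (R : realType) (f : R -> R) : Prop :=
  exists x : R, [/\ x \in `[-1, 1],
    {in `[-1, x] &, {homo f : a b / a <= b}} &
    {in `[x, 1] &, {homo f : a b /~ a <= b}}].

Definition quasiconcave_smooth_density (R : realType) (phi : R)
    (f : R -> R) : Prop :=
  smooth_density phi f /\ quasiconcave f.

Definition drawn_from (R : realType) (disp : measure_display)
    (T : measurableType disp) (P : probability T R)
    (X : {RV P >-> R}) (f : R -> R) : Prop :=
  forall B : set R, measurable B ->
    distribution P X B =
    (\int[lebesgue_measure]_(x in B `&` `[(-1 : R)%R, 1%R]) (f x)%:E)%E.

Definition mutually_independent (R : realType) (disp : measure_display)
    (T : measurableType disp) (P : probability T R)
    (I : finType) (X : I -> {RV P >-> R}) : Prop :=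
  forall (J : {set I}) (B : I -> set R),
    (forall i, i \in J -> measurable (B i)) ->
    P (\bigcap_(i in [set` J]) (X i @^-1` B i)) =
    (\prod_(i in J) P (X i @^-1` B i))%E.

(* Supremum over all adversarial choices (S, W, f) with every density f t i in
   the class D. The coefficients are modelled as independent random variables
   on any probability space carrying them; the expectation depends only on
   their joint law, hence only on (S, W, f). *)
Definition smoothed_moment (R : realType) (D : (R -> R) -> Prop)
    (d n c : nat) : \bar R :=
  ereal_sup [set m : \bar R |
    exists (S : {set cube n}) (W : cube n -> R) (f : 'I_d -> 'I_n -> R -> R)
      (disp : measure_display) (T : measurableType disp)
      (P : probability T R) (V : 'I_d -> 'I_n -> {RV P >-> R}),
    [/\ forall t i, D (f t i),
        forall t i, drawn_from (V t i) (f t i),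
        mutually_independent (fun ti : 'I_d * 'I_n => V ti.1 ti.2) &
        m =
            'E_P[(fun w => (PO S W (\matrix_(t, i) V t i w))%:R ^+ c)%R]%E]].

(* Main.v *)
(* After Brunsch and Roeglin. The coefficients are rounded to a grid of mesh 1/N.
   Unless two solutions nearly tie in some objective, which has probability
   O(1/N), a Pareto-optimal solution stays so strictly after rounding; hence it
   suffices to bound, for a large N, a sum over integer matrices u weighted by
   products of cell masses p_i(u_i).

   Each Pareto-optimal solution x is found by a run that visits d further
   solutions, the t-th of which differs from x at a marked position i_t. For a
   c-tuple of solutions the runs are restricted one after the other to the
   solutions agreeing with x at the positions already marked, so all the cd
   positions are distinct. Guess the positions (n^(cd) ways) and the patterns
   of the visited solutions on them (a constant number of ways). Of the d * cd
   marked coefficients the runs then use cd(d-1) linear combinations with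
   coefficients in {-1, 0, 1}, and cd offset objective values of x, each with
   O(nN) possible values. All these numbers and the unmarked coefficients
   determine the c-tuple, and then, the pattern differences being triangular,
   the marked coefficients too.

   So, for fixed offset values, the sum runs over a section of the fibres of
   the combinations. For densities bounded by phi it has O(N)^(cd(d-1)) terms
   of marked weight at most (phi/N)^(cd^2). For quasiconcave densities the cell
   masses have total variation at most 4phi/N, which bounds the sum over the
   section by a constant times (phi/N)^(cd). *)

Require Import Defs.
From HB Require Import structures.
From mathcomp Require Import all_boot all_order all_algebra.
From mathcomp Require Import all_classical all_reals all_analysis.
From mathcomp Require Import measurable_realfun.
From mathcomp Require Import ring lra zify.
Import Order.TTheory GRing.Theory Num.Theory.
Import numFieldNormedType.Exports.
Local Open Scope ring_scope.

Set Implicit Arguments.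
Unset Strict Implicit.
Unset Printing Implicit Defensive.

(** * Sums of product weights over sections *)

Section SubProbability.
Variable R : realFieldType.

Lemma ler_sum_sub (T : eqType) (s1 s2 : seq T) (F : T -> R) :
  uniq s1 -> uniq s2 -> {subset s1 <= s2} -> (forall x, 0 <= F x) ->
  \sum_(x <- s1) F x <= \sum_(x <- s2) F x.
Proof.
move=> u1 u2 s12 F0; rewrite [leRHS](bigID (mem s1))/=.
have E : perm_eq [seq x <- s2 | x \in s1] s1.
  apply: uniq_perm => // [|x]; first exact: filter_uniq.
  by rewrite mem_filter; case: (boolP (x \in s1)) => // /s12.
rewrite -[X in _ <= X + _]big_filter (perm_big _ E)/= lerDl.
by apply: sumr_ge0.
Qed.

(** Bounding sums over finite duplicate-free lists keeps infinite sums out of the discrete part. *)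
Definition submass (p : int -> R) :=
  (forall a, 0 <= p a) /\ forall s, uniq s -> \sum_(a <- s) p a <= 1.

(** [Om] lies in the finite grid of all values its vectors take, and over a full grid the sum of
    products is a product of sums. *)
Lemma submass_prod (I : finType) (p : I -> int -> R)
    (Om : seq {ffun I -> int}) :
  (forall i, submass (p i)) -> uniq Om ->
  \sum_(v <- Om) \prod_i p i (v i) <= 1.
Proof.
move=> hp uOm.
pose s := flatten [seq [seq v i | i : I] | v : {ffun I -> int} <- Om].
pose lift (f : {ffun I -> seq_sub s}) := [ffun i => val (f i)].
have lift_inj : injective lift.
  by move=> f g /ffunP fg; apply/ffunP => i; apply: val_inj; have := fg i; rewrite !ffunE.
apply: (@le_trans _ _ (\sum_(v <- [seq lift f | f : {ffun I -> seq_sub s}])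
    \prod_i p i (v i))).
  apply: ler_sum_sub => //.
  - by rewrite map_inj_uniq ?enum_uniq.
  - move=> v vOm.
    have hv i : v i \in s.
      apply/flattenP; exists [seq v i | i : I]; first by apply/mapP; exists v.
      by apply/mapP; exists i; rewrite ?mem_enum.
    apply/mapP; exists [ffun i => SeqSub (hv i)]; rewrite ?mem_enum//.
    by apply/ffunP => i; rewrite !ffunE.
  - by move=> v; apply: prodr_ge0 => i _; apply: (hp i).1.
rewrite big_map big_enum /=.
under eq_bigr do under eq_bigr do rewrite ffunE.
rewrite -(bigA_distr_bigA (fun i (t : seq_sub s) => p i (val t))).
apply: prodr_ile1 => i; rewrite sumr_ge0/=; last by move=> t _; apply: (hp i).1.
rewrite -big_enum/= -(big_map val xpredT (p i)) => _; apply: (hp i).2.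
by rewrite map_inj_uniq ?enum_uniq//; apply: val_inj.
Qed.

Lemma submass_point (a : int) : submass (fun b => (b == a)%:R).
Proof.
split=> [b|s us]; first by rewrite ler0n.
case: (boolP (a \in s)) => aS.
  rewrite (bigD1_seq a)//= eqxx big1 ?addr0// => b /negPf ->//.
rewrite big_seq big1 ?ler01// => b bs.
by case: eqP => // ba; rewrite -ba bs in aS.
Qed.

(** The factors in [A] cost [M] each; distinct vectors differ outside [A], so the remaining products
    sum to at most 1. *)
Lemma submass_prod_det (I : finType) (p : I -> int -> R) (A : {set I}) (M : R)
    (Om : seq {ffun I -> int}) :
  (forall i, submass (p i)) -> (forall i, i \in A -> forall a, p i a <= M) ->
  uniq Om ->
  (forall v w : {ffun I -> int}, v \in Om -> w \in Om ->
    (forall i, i \notin A -> v i = w i) -> v = w) ->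
  \sum_(v <- Om) \prod_i p i (v i) <= M ^+ #|A|.
Proof.
move=> hp hM uOm det.
have [->|[v0 v0Om]] : Om = [::] \/ exists v, v \in Om.
  by case: Om uOm det => [|v s]; [left|right; exists v; rewrite inE eqxx].
  rewrite big_nil; case: (set_0Vmem A) => [->|[i iA]]; first by rewrite cards0 expr0.
  by apply: exprn_ge0; apply: le_trans (hM i iA 0); apply: (hp i).1.
pose res (v : {ffun I -> int}) := [ffun i => if i \in A then 0 else v i].
pose p' i := if i \in A then fun b : int => (b == 0)%:R : R else p i.
have hp' i : submass (p' i).
  by rewrite /p'; case: ifP => _ //; apply: submass_point.
have M0 : 0 <= M ^+ #|A|.
  case: (set_0Vmem A) => [->|[i iA]]; first by rewrite cards0 expr0.
  by apply: exprn_ge0; apply: le_trans (hM i iA 0); apply: (hp i).1.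
apply: (@le_trans _ _ (\sum_(v <- map res Om) (M ^+ #|A| * \prod_i p' i (v i)))).
  rewrite big_map; apply: ler_sum => v _.
  rewrite (bigID (mem A))/= [in leRHS](bigID (mem A))/=.
  rewrite [X in _ <= _ * (X * _)]big1 ?mul1r; last first.
    by move=> i iA; rewrite /p' ffunE iA.
  have -> : \prod_(i | i \notin A) p' i (res v i) = \prod_(i | i \notin A) p i (v i).
    by apply: eq_bigr => i /negPf iA; rewrite /p' ffunE iA.
  apply: ler_wpM2r; first by apply: prodr_ge0 => i _; apply: (hp i).1.
  rewrite -prodr_const; apply: ler_prod => i iA.
  by rewrite (hp i).1 hM.
rewrite -mulr_sumr -[leRHS]mulr1; apply: ler_wpM2l => //.
apply: submass_prod => //.
rewrite map_inj_in_uniq// => v w vO wO /ffunP vw; apply: det => // i /negPf iA.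
by have := vw i; rewrite !ffunE iA.
Qed.

End SubProbability.

(** * Small integer kernel vectors *)

Section SmallKernelVector.

(** Siegel's lemma by the pigeonhole principle: two vectors with entries in [[0, h]] on [#|Q| + 1]
    positions of [A] have the same image, and their difference is taken. *)
Lemma small_kernel_vector (I Q : finType) (B : Q -> I -> int) (A : {set I}) :
  (#|Q| < #|A|)%N -> (forall j i, `|B j i| <= 1) ->
  exists w : I -> int,
    [/\ exists i, w i != 0, forall i, i \notin A -> w i = 0,
        forall j, \sum_i B j i * w i = 0 &
        (\sum_i `|w i| <= #|Q|.+1 * (2 * #|Q| + 3) ^ #|Q|)%N].
Proof.
move=> QA hB; set q := #|Q|; set h := ((2 * q + 3) ^ q)%N.
pose e (k : 'I_q.+1) : I := enum_val (widen_ord QA k).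
have e_inj : injective e.
  by move=> k l /enum_val_inj /(congr1 val) /= kl; apply: val_inj.
have eA k : e k \in A by apply: enum_valP.
pose val_at (f : {ffun 'I_q.+1 -> 'I_h.+1}) j : int := \sum_k B j (e k) * (f k)%:Z.
have val_le f j : `|val_at f j| <= (q.+1 * h)%:Z.
  apply: le_trans (ler_norm_sum _ _ _) _.
  apply: (@le_trans _ _ (\sum_(k < q.+1) h%:Z)).
    apply: ler_sum => k _; rewrite normrM; have := hB j (e k).
    have : `|(f k)%:Z| <= h%:Z by have := ltn_ord (f k); lia.
    have := normr_ge0 (B j (e k)); nia.
  by rewrite sumr_const card_ord -mulr_natr; lia.
pose F f : {ffun Q -> 'I_(2 * (q.+1 * h)).+1} :=
  [ffun j => inord (absz (val_at f j + (q.+1 * h)%:Z)%R)].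
have : ~~ injectiveb F.
  apply/negP => /injectiveP /leq_card; rewrite !card_ffun !card_ord -/q.
  apply/negP; rewrite -ltnNge.
  (* There are at most [((2q + 3)(h + 1))^q = h (h + 1)^q] images, fewer than the [(h + 1)^(q + 1)]
     vectors. *)
  apply: (@leq_ltn_trans ((2 * q + 3) ^ q * h.+1 ^ q)%N).
    by rewrite -expnMn; case: (q) => // q'; rewrite leq_exp2r//; nia.
  by rewrite expnS -/h ltn_pmul2r// expn_gt0.
case/injectivePn => f [g fg /ffunP FE].
have valE j : val_at f j = val_at g j.
  have := FE j; rewrite !ffunE => /(congr1 val) /=.
  have := val_le f j; have := val_le g j => ? ?.
  rewrite !inordK; lia.
pose w i : int := \sum_(k | e k == i) ((f k)%:Z - (g k)%:Z).
have we k : w (e k) = (f k)%:Z - (g k)%:Z.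
  by rewrite /w (bigD1 k)//= big1 ?addr0// => l /andP[/eqP /e_inj ->]; rewrite eqxx.
have sum_e (G : I -> int -> int) : (forall i, G i 0 = 0) ->
    \sum_i G i (w i) = \sum_k G (e k) ((f k)%:Z - (g k)%:Z).
  move=> G0; rewrite [RHS](partition_big e xpredT)//=; apply: eq_bigr => i _.
  case: (pickP (fun k => e k == i)) => [k /eqP <-|no].
    by rewrite we (bigD1 k)//= big1 ?addr0// => l /andP[/eqP /e_inj ->]; rewrite eqxx.
  by rewrite /w !big_pred0.
exists w; split.
- have [k fgk] : exists k, f k != g k.
    apply/existsP; apply: contraNT fg; rewrite negb_exists => /forallP fg.
    by apply/eqP/ffunP => k; apply/eqP; rewrite -[_ == _]negbK.
  exists (e k); rewrite we subr_eq0; apply: contraNneq fgk => E.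
  by apply/eqP/val_inj; case: E.
- move=> i iA; rewrite /w big_pred0// => k; apply: contraNF iA => /eqP <-.
  exact: eA.
- move=> j; rewrite (sum_e (fun i x => B j i * x)); last by move=> i; rewrite mulr0.
  under eq_bigr do rewrite mulrBr.
  by rewrite sumrB -/(val_at f j) -/(val_at g j) valE subrr.
- suff : ((\sum_i `|w i|)%N)%:Z <= (q.+1 * h)%:Z by lia.
  rewrite (big_morph Posz PoszD (erefl _)) (sum_e (fun _ x => `|x|%N%:Z))//.
  apply: (@le_trans _ _ (\sum_(k < q.+1) h%:Z)).
    by apply: ler_sum => k _; have := ltn_ord (f k); have := ltn_ord (g k); lia.
  by rewrite sumr_const card_ord -mulr_natr; lia.
Qed.

End SmallKernelVector.

(** * Total variation on the integers *)

Section TotalVariation.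
Variable R : realFieldType.
Implicit Types (p : int -> R) (b : R).

Definition variation_le b p :=
  forall s, uniq s -> \sum_(a <- s) `|p (a + 1) - p a| <= b.

Definition bounded_support p := exists K : nat, forall a, (K < `|a|)%N -> p a = 0.

Lemma uniq_shift (m : int) (s : seq int) : uniq s -> uniq [seq a + m | a <- s].
Proof. by rewrite map_inj_uniq//; apply: addIr. Qed.

Lemma submass_shift p m : submass p -> submass (fun a => p (a + m)).
Proof.
move=> [p0 p1]; split=> // s /(uniq_shift m) /p1.
by rewrite big_map.
Qed.

Lemma variation_le_shift b p m :
  variation_le b p -> variation_le b (fun a => p (a + m)).
Proof.
move=> hp s /(uniq_shift m) /hp; rewrite big_map.
by under eq_bigr do rewrite addrAC.
Qed.

Lemma bounded_support_shift p m :
  bounded_support p -> bounded_support (fun a => p (a + m)).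
Proof.
by case=> K hK; exists (K + `|m|)%N => a ha; apply: hK; lia.
Qed.

(** A jump by [m] is a chain of [|m|] unit steps; a negative [m] is reduced to a positive one by
    shifting the list. *)
Lemma variation_le_jump b p (m : int) (s : seq int) :
  variation_le b p -> uniq s ->
  \sum_(a <- s) `|p (a + m) - p a| <= `|m|%N%:R * b.
Proof.
have pos (n : nat) t : variation_le b p -> uniq t ->
    \sum_(a <- t) `|p (a + n%:Z) - p a| <= n%:R * b.
  move=> hp ut; elim: n => [|n IH].
    by rewrite mul0r big1// => a _; rewrite addr0 subrr normr0.
  apply: (@le_trans _ _ (\sum_(a <- t) (`|p (a + n%:Z + 1) - p (a + n%:Z)| +
      `|p (a + n%:Z) - p a|))).
    apply: ler_sum => a _; rewrite -[n.+1]addn1 PoszD addrA.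
    by apply: le_trans (ler_normD _ _); rewrite addrA subrK.
  rewrite big_split/= -[n.+1]add1n natrD mulrDl mul1r lerD//.
  by under eq_bigr do rewrite addrAC; apply: (variation_le_shift n%:Z hp).
move=> hp us; have [m0|m0] := leP 0 m.
  by rewrite -{1}(gez0_abs m0); apply: pos.
rewrite (le_trans _ (pos `|m|%N _ hp (uniq_shift m us)))// big_map.
apply: ler_sum => a _; rewrite distrC.
by have -> : a + m + `|m|%N%:Z = a by lia.
Qed.

(** The factors [a i] are exchanged for [b i] one at a time, in the order of [enum_rank], and the
    differences telescope. *)
Lemma prod_hybrid (I : finType) (a b : I -> R) :
  (forall i, 0 <= a i) -> (forall i, 0 <= b i) ->
  `|\prod_i a i - \prod_i b i| <= \sum_i `|a i - b i| *
     \prod_(j | j != i) (if (enum_rank j < enum_rank i)%N then b j else a j).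
Proof.
move=> a0 b0.
pose H (k : nat) := \prod_i (if (enum_rank i < k)%N then b i else a i).
have -> : \prod_i a i - \prod_i b i = \sum_(0 <= k < #|I|) - (H k.+1 - H k).
  rewrite sumrN telescope_sumr// opprB /H; congr (_ - _).
  by apply: eq_bigr => i _; rewrite ltn_ord.
apply: le_trans (ler_norm_sum _ _ _) _; rewrite big_mkord.
rewrite (reindex (@enum_val I xpredT))/=; last first.
  by exists enum_rank => i _; [apply: enum_valK|apply: enum_rankK].
apply: ler_sum => k _; rewrite normrN enum_valK.
have [/=Hb Ha] : H k.+1 = b (enum_val k) * \prod_(j | j != enum_val k)
      (if (enum_rank j < k)%N then b j else a j)
    /\ H k = a (enum_val k) * \prod_(j | j != enum_val k)
      (if (enum_rank j < k)%N then b j else a j).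
  rewrite /H !(bigD1 (P := xpredT) (enum_val k))//= enum_valK ltnSn ltnn.
  split=> //; congr (_ * _); apply: eq_bigr => j jk.
  rewrite ltnS leq_eqVlt; case: eqP => // /val_inj E.
  by move: jk; rewrite -E enum_rankK eqxx.
rewrite Hb Ha -mulrBl normrM distrC ler_wpM2l// ger0_norm//.
by apply: prodr_ge0 => j _; case: ifP.
Qed.

(* Were the sums integrals, this would bound the integral of the supremum of a
   product density over the fibres of [v |-> B v]. One fibre direction is
   removed at a time: along it a function is at most its total variation, and
   the discrete Leibniz rule makes one factor a difference, which replaces a
   bound on that factor. *)
Lemma submass_prod_variation (I Q : finType) (B : Q -> I -> int) (b : R) :
  0 < b -> (forall j i, `|B j i| <= 1) ->
  forall r (A : {set I}) (p : I -> int -> R) (Om : seq {ffun I -> int}),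
  #|A| = (#|Q| + r)%N ->
  (forall i, submass (p i)) -> (forall i, bounded_support (p i)) ->
  (forall i, i \in A -> variation_le b (p i)) -> uniq Om ->
  (forall v w : {ffun I -> int}, v \in Om -> w \in Om ->
    (forall i, i \notin A -> v i = w i) ->
    (forall j, \sum_i B j i * v i = \sum_i B j i * w i) -> v = w) ->
  \sum_(v <- Om) \prod_i p i (v i)
    <= ((#|Q|.+1 * (2 * #|Q| + 3) ^ #|Q|)%:R * b) ^+ r.
Proof.
move=> b0 hB; elim=> [|r IH] A p Om cA hp sp vp uOm det.
  by rewrite expr0; apply: submass_prod.
set C : R := _ * b.
(* As [A] has more than [#|Q|] elements, there is a direction [w] that moves only coordinates in [A]
   and changes no combination. *)
have [|w [[i0 wi0] wA Bw wC]] := small_kernel_vector (A := A) _ hB.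
  by rewrite cA; lia.
pose sh (v : {ffun I -> int}) (k : nat) : {ffun I -> int} :=
  [ffun i => v i + k%:Z * w i].
have shS v k : sh (sh v k) 1%N = sh v k.+1.
  by apply/ffunP => i; rewrite !ffunE; lia.
pose h (v : {ffun I -> int}) := \prod_i p i (v i).
have h0 v : 0 <= h v by apply: prodr_ge0 => i _; apply: (hp i).1.
have [K hK] := sp i0.
(* After [J] steps along [w] the coordinate [i0] of every vector of [Om] has left the support of
   [p i0]. *)
pose J := (K + \max_(v <- Om) `|v i0| + 1)%N.
have hJ v : v \in Om -> h (sh v J) = 0.
  move=> vO; have := leq_bigmax_seq (P := xpredT) (F := fun v : {ffun I -> int} => `|v i0|%N) v vO isT.
  move=> /= vm; rewrite /h (bigD1 i0)//= hK ?mul0r// ffunE /J; nia.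
pose Om' : seq {ffun I -> int} := [seq sh v k | v <- Om, k <- iota 0 J].
have sh_inj v v' k k' : v \in Om -> v' \in Om -> sh v k = sh v' k' ->
    v = v' /\ k = k'.
  move=> vO vO' /ffunP E.
  have vv' : v = v'.
    apply: det => // [i /wA wi|j].
      by have := E i; rewrite !ffunE wi !mulr0 !addr0.
    have : \sum_i B j i * sh v k i = \sum_i B j i * sh v' k' i.
      by apply: eq_bigr => i _; rewrite E.
    have shB u l : \sum_i B j i * sh u l i = \sum_i B j i * u i.
      under eq_bigr do rewrite ffunE mulrDr mulrCA.
      by rewrite big_split/= -mulr_sumr Bw mulr0 addr0.
    by rewrite !shB.
  split=> //; have := E i0; rewrite !ffunE vv' => /addrI /(mulIf wi0); lia.
have uOm' : uniq Om'.
  apply: allpairs_uniq => //; first exact: iota_uniq.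
  case=> v k [v' k'] /allpairsP[[v1 k1] /= [v1O _ [-> ->]]].
  move=> /allpairsP[[v2 k2] /= [v2O _ [-> ->]]] /= E.
  by have [-> ->] := sh_inj _ _ _ _ v1O v2O E.
(* [h v] is the sum of its decrements along the ray from [v], at whose end [h] vanishes. *)
have step1 : \sum_(v <- Om) h v <= \sum_(v <- Om') `|h v - h (sh v 1%N)|.
  rewrite big_allpairs_dep/= big_seq [leRHS]big_seq; apply: ler_sum => v vO.
  have {1}-> : v = sh v 0%N by apply/ffunP => i; rewrite ffunE mul0r addr0.
  rewrite -[leLHS]subr0 -{1}(hJ v vO) -[leLHS]opprB -(telescope_sumr (fun k => h (sh v k)))//.
  rewrite -sumrN /index_iota subn0; apply: ler_sum => k _.
  by rewrite shS opprB ler_norm.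
apply: le_trans step1 _.
pose f (i j : I) : int -> R :=
  if (enum_rank j < enum_rank i)%N then fun x => p j (x + w j) else p j.
have step2 : \sum_(v <- Om') `|h v - h (sh v 1%N)| <=
    \sum_i \sum_(v <- Om') `|p i (v i + w i) - p i (v i)| *
      \prod_(j | j != i) f i j (v j).
  rewrite exchange_big/=; apply: ler_sum => v _.
  have := @prod_hybrid I (fun i => p i (v i)) (fun i => p i (v i + w i)).
  have -> : \prod_i p i (v i + w i) = h (sh v 1%N).
    by apply: eq_bigr => i _; rewrite ffunE mul1r.
  move=> /(_ (fun i => (hp i).1 _) (fun i => (hp i).1 _)) H.
  apply: le_trans H _; apply: ler_sum => i _; rewrite distrC ler_wpM2l//.
  by apply: ler_prod => j _; rewrite /f; case: ifP => _; rewrite (hp j).1 lexx.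
apply: le_trans step2 _.
apply: (@le_trans _ _ (\sum_i `|w i|%N%:R * (b * C ^+ r))); last first.
  rewrite -mulr_suml -natr_sum exprS /C mulrA.
  apply: ler_wpM2r; first by apply: exprn_ge0; apply: mulr_ge0 => //; apply: ltW.
  by rewrite ler_pM2r// ler_nat.
apply: ler_sum => i _.
have [wi|wi] := eqVneq (w i) 0.
  by rewrite wi mul0r big1// => v _; rewrite addr0 subrr normr0 mul0r.
have iA : i \in A by apply: contraNT wi => /wA ->.
have wi_gt0 : 0 < `|w i|%N%:R * b :> R by rewrite mulr_gt0// ltr0n absz_gt0.
(* Divided by its variation bound, the difference in factor [i] is a submass again. The divisor
   [|w i| * b] supplies one power of [b], and [i] leaves [A]. *)
pose p' j := if j == i then fun x => (`|w i|%N%:R * b)^-1 * `|p i (x + w i) - p i x|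
   else f i j.
have E v : `|p i (v i + w i) - p i (v i)| * \prod_(j | j != i) f i j (v j) =
    (`|w i|%N%:R * b) * \prod_j p' j (v j).
  rewrite (bigD1 (P := xpredT) i)//= {1}/p' eqxx !mulrA mulfV ?gt_eqF// mul1r.
  by congr (_ * _); apply: eq_bigr => j /negPf ji; rewrite /p' ji.
under eq_bigr do rewrite E.
rewrite -mulr_sumr mulrA ler_pM2l//.
apply: (IH (A :\ i)) => //.
- by have := cardsD1 i A; rewrite iA cA; lia.
- move=> j; rewrite /p'; case: eqP => [_|_].
    split=> [x|s us]; first by rewrite mulr_ge0 ?invr_ge0// ltW.
    rewrite -mulr_sumr ler_pdivrMl// mulr1.
    by apply: variation_le_jump => //; apply: vp.
  rewrite /f; case: ifP => _ //; exact: submass_shift.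
- move=> j; rewrite /p'; case: eqP => [_|_].
    have [K' hK'] := sp i; exists (K' + `|w i|)%N => a ha.
    by rewrite !hK' ?subrr ?normr0 ?mulr0//; lia.
  rewrite /f; case: ifP => _ //; exact: bounded_support_shift.
- move=> j; rewrite !inE => /andP[/negPf ji jA]; rewrite /p' ji /f.
  by case: ifP => _; [apply: variation_le_shift|]; apply: vp.
(* Coordinate [i] is now among the known ones and, [w i] being nonzero, tells the number of steps
   along the ray. *)
- move=> v1 v2 /allpairsPdep[v [k [vO _ ->]]] /allpairsPdep[v' [k' [vO' _ ->]]] Eoff EB.
  suff [-> ->] : v = v' /\ k = k' by [].
  have vv' : v = v'.
    apply: det => // [l lA|j].
      have := Eoff l; rewrite !inE (negPf lA) andbF !ffunE wA// => /(_ isT).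
      by rewrite !mulr0 !addr0.
    have shB u l : \sum_i B j i * sh u l i = \sum_i B j i * u i.
      under eq_bigr do rewrite ffunE mulrDr mulrCA.
      by rewrite big_split/= -mulr_sumr Bw mulr0 addr0.
    by have := EB j; rewrite !shB.
  split=> //; have := Eoff i; rewrite !inE eqxx !ffunE vv' => /(_ isT).
  by move=> /addrI /(mulIf wi); lia.
Qed.

End TotalVariation.

(** * Witness runs *)

Section Witness.
Variables (R : realDomainType) (T : finType).
Implicit Types (obj : nat -> {ffun T -> bool} -> R) (x z : {ffun T -> bool})
  (S : {set {ffun T -> bool}}) (J : {set T})
  (ix : nat -> T) (fl : nat -> bool) (zz : nat -> {ffun T -> bool}).

(* Step [t.+1] looks at the solutions of [S] that are no worse than [x] in the
   objectives [0, ..., t]. If there are any ([fl t.+1]), [zz t.+1] is the one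
   among them that is best in objective [t.+1], and only solutions beating it
   are kept. In both cases only solutions agreeing with [x] at the position
   [ix t.+1], where [zz t.+1] and [x] differ, are kept. *)
Fixpoint witness_run obj d S x ix fl zz : Prop :=
  if d is t.+1 then
    [/\ zz t.+1 (ix t.+1) != x (ix t.+1),
      fl t.+1 -> [/\ zz t.+1 \in S,
        forall k, (k <= t)%N -> obj k (zz t.+1) <= obj k x &
        forall z, z \in S -> z != x ->
          (forall k, (k <= t)%N -> obj k z <= obj k x) ->
          obj t.+1 (zz t.+1) <= obj t.+1 z] &
      witness_run obj t
        [set z in S | (z (ix t.+1) == x (ix t.+1)) &&
           (fl t.+1 ==> (obj t.+1 z < obj t.+1 (zz t.+1)))] x ix fl zz]
  else x \in S /\ forall z, z \in S -> z != x -> obj 0 x < obj 0 z.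

Lemma witness_run_ext obj d S x ix fl zz ix' fl' zz' :
  (forall t, (0 < t <= d)%N -> [/\ ix t = ix' t, fl t = fl' t & zz t = zz' t]) ->
  witness_run obj d S x ix fl zz -> witness_run obj d S x ix' fl' zz'.
Proof.
elim: d S => [//|d IH] S E /=.
have [|<- <- <-] := E d.+1; first by rewrite leqnn.
by case=> h1 h2 h3; split=> //; apply: IH h3 => t /andP[t0 td]; apply: E; rewrite t0 leqW.
Qed.

Lemma witness_run_neq obj d S x ix fl zz t :
  witness_run obj d S x ix fl zz -> (0 < t <= d)%N -> zz t (ix t) != x (ix t).
Proof.
elim: d S => [S|d IH S /= [neq _ /IH run]]; first by lia.
by have [-> //|td tb] := eqVneq t d.+1; apply: run; lia.
Qed.

(** The optimality in the last hypothesis is passed down: a solution no worse than [x] in objectives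
    [0, ..., d] cannot beat the minimizer [zt] in objective [d.+1], so among the survivors [x]
    satisfies the same hypothesis with [d] for [d.+1]. [J] holds the positions fixed so far. *)
Lemma witness_run_exists obj d S x J (a0 : T) :
  (#|J| + d <= #|T|)%N -> x \in S ->
  (forall z, z \in S -> {in J, z =1 x}) ->
  (forall z, z \in S -> z != x ->
    (forall k, (k < d)%N -> obj k z <= obj k x) -> obj d x < obj d z) ->
  exists ix fl zz, [/\ witness_run obj d S x ix fl zz, zz 0 = x,
    forall t, (t <= d)%N -> {in J, zz t =1 x},
    forall t, (0 < t <= d)%N -> ix t \notin J &
    forall t s, (t < s <= d)%N ->
      zz t (ix s) = x (ix s) /\ ((0 < t)%N -> ix t != ix s)].
Proof.
elim: d S J => [|d IH] S J cJ xS SJ opt.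
  exists (fun=> a0), (fun=> false), (fun=> x); split=> //=.
  - by split=> // z zS zx; apply: opt.
  - by move=> t; lia.
  - by move=> t s; lia.
have [a [zt [f [aJ zta ztJ hf optf]]]] : exists a (zt : {ffun T -> bool}) (f : bool),
    [/\ a \notin J, zt a != x a, {in J, zt =1 x},
      f -> [/\ zt \in S, forall k, (k <= d)%N -> obj k zt <= obj k x,
        obj d.+1 x < obj d.+1 zt &
        forall z, z \in S -> z != x ->
          (forall k, (k <= d)%N -> obj k z <= obj k x) ->
          obj d.+1 zt <= obj d.+1 z] &
      forall z, z \in S -> z != x -> (f -> obj d.+1 z < obj d.+1 zt) ->
          (forall k, (k < d)%N -> obj k z <= obj k x) -> obj d x < obj d z].
  pose P z := [&& z \in S, z != x & [forall k : 'I_d.+1, obj k z <= obj k x]].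
  have PP z : P z <-> [/\ z \in S, z != x &
      forall k, (k <= d)%N -> obj k z <= obj k x].
    split=> [/and3P[zS zx /forallP h]|[zS zx h]].
      by split=> // k kd; apply: (h (Ordinal (kd : (k < d.+1)%N))).
    by apply/and3P; split=> //; apply/forallP => k; apply: h; rewrite -ltnS.
  have lt_of_not z : z \in S -> z != x ->
      (forall k, (k < d)%N -> obj k z <= obj k x) -> ~ P z -> obj d x < obj d z.
    move=> zS zx h nP; rewrite ltNge; apply/negP => le; apply/nP/PP; split=> // k.
    by rewrite leq_eqVlt => /predU1P[->|/h].
  have [z0 Pz0|noP] := pickP P.
    have [zt Pzt ztmin] := arg_minP (obj d.+1) Pz0.
    have [ztS ztx zth] := (PP zt).1 Pzt.
    have [a zta] : exists a, zt a != x a.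
      apply/existsP; apply: contraNT ztx; rewrite negb_exists => /forallP h.
      by apply/eqP/ffunP => a; apply/eqP; have := h a; rewrite negbK.
    exists a, zt, true; split=> //.
    - by apply: contraNN zta => /(SJ _ ztS) ->.
    - exact: SJ.
    - move=> _; split=> //; first exact: opt.
      by move=> z zS zx h; apply: ztmin; apply/PP.
    - move=> z zS zx lt h; apply: lt_of_not => // Pz.
      by have := ztmin z Pz; rewrite leNgt lt.
  have [a aJ] : exists a, a \notin J.
    have : (0 < #|~: J|)%N by rewrite cardsCs finset.setCK; lia.
    by case/card_gt0P => a; rewrite inE => aJ; exists a.
  (* Without a candidate, [x] flipped at a fresh position is a placeholder; as the flag is false, it
     may be infeasible. *)
  exists a, [ffun b => if b == a then ~~ x b else x b], false; split=> //.
  - by rewrite ffunE eqxx; case: (x a).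
  - by move=> b bJ; rewrite ffunE; case: eqP => // ba; rewrite -ba bJ in aJ.
  - by move=> z zS zx _ h; apply: lt_of_not => //; rewrite noP.
(* Adding [a] to [J] makes all solutions visited later agree with [x] there, whence the triangular
   patterns. *)
pose S' := [set z in S | (z a == x a) && (f ==> (obj d.+1 z < obj d.+1 zt))].
have [||z|z|ix [fl [zz [run zz0 zzJ ixJ tri]]]] := IH S' (a |: J).
- by rewrite cardsU1 aJ; lia.
- by rewrite inE xS eqxx; apply/implyP => /hf[].
- by rewrite inE => /andP[zS /andP[/eqP za _]] b; rewrite !inE => /predU1P[->|/(SJ _ zS)].
- by rewrite inE => /andP[zS /andP[_ /implyP lt]] zx; apply: optf.
exists (fun t => if t == d.+1 then a else ix t),
  (fun t => if t == d.+1 then f else fl t),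
  (fun t => if t == d.+1 then zt else zz t); split=> //=.
- rewrite !eqxx; split=> // [/hf[] //|].
  apply: witness_run_ext run => t /andP[_ td].
  by have /negPf -> : t != d.+1 by lia.
- move=> t; rewrite leq_eqVlt; case: eqP => // _ /= td b bJ.
  by apply: zzJ; rewrite // !inE bJ orbT.
- move=> t; case: eqP => // td /andP[t0 td'].
  by have := ixJ t; rewrite !inE negb_or => /(_ _)/andP[]//; lia.
- move=> t s /andP[ts sd]; have /negPf -> : t != d.+1 by lia.
  have td : (t <= d)%N by lia.
  case: eqP => [_|sd']; last by apply: tri; lia.
  split=> [|t0]; first by apply: zzJ; rewrite // !inE eqxx.
  by apply: contraTneq isT => ta; have := ixJ t; rewrite ta !inE eqxx t0 td => /(_ isT).
Qed.

(* Two runs for different inputs find the same solution provided they visit the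
   same positions and the same patterns on [J], and all the comparisons made
   along the way agree. *)
Lemma witness_run_unique obj1 obj2 d S1 S2 x1 x2 ix fl zz1 zz2 J :
  (forall t, (0 < t <= d)%N -> ix t \in J) ->
  zz1 0 = x1 -> zz2 0 = x2 ->
  (forall t, (t <= d)%N -> {in J, zz1 t =1 zz2 t}) ->
  (forall t z, (t <= d)%N -> {in J, z =1 zz1 t} -> (z \in S1) = (z \in S2)) ->
  (forall k t z z', (t <= k <= d)%N -> {in J, z =1 zz1 t} ->
    {in J, z' =1 zz1 k} -> obj1 k z - obj1 k z' = obj2 k z - obj2 k z') ->
  (forall k t z, (k < t <= d)%N -> {in J, z =1 zz1 t} ->
    obj1 k z - obj1 k x1 = obj2 k z - obj2 k x2) ->
  witness_run obj1 d S1 x1 ix fl zz1 -> witness_run obj2 d S2 x2 ix fl zz2 ->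
  x1 = x2.
Proof.
elim: d S1 S2 => [|d IH] S1 S2 ixJ zz10 zz20 zzJ SS diff diffx /=.
  case=> x1S1 min1 [x2S2 min2]; apply/eqP; apply: contraT => neq.
  have J12 := zzJ 0 (leqnn _); rewrite zz10 zz20 in J12.
  have J1 : {in J, x1 =1 zz1 0} by rewrite zz10.
  have J2 : {in J, x2 =1 zz1 0} by move=> b bJ; rewrite zz10 J12.
  have x2S1 : x2 \in S1 by rewrite (SS 0).
  have x1S2 : x1 \in S2 by rewrite -(SS 0).
  have := min1 x2 x2S1; rewrite eq_sym => /(_ neq) lt1.
  have := min2 x1 x1S2 neq => lt2.
  by have := diff 0 0 x1 x2 isT J1 J2; lra.
move=> [b1 f1 run1] [b2 f2 run2].
have x12 : x1 (ix d.+1) = x2 (ix d.+1).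
  by rewrite -zz10 -zz20; apply: zzJ => //; apply: ixJ; rewrite leqnn.
have leE k t z : (k < t <= d.+1)%N -> {in J, z =1 zz1 t} ->
    (obj1 k z <= obj1 k x1) = (obj2 k z <= obj2 k x2).
  by move=> kt zJ; rewrite -subr_le0 (diffx k t)// subr_le0.
have zJ2 : {in J, zz2 d.+1 =1 zz1 d.+1} by move=> b bJ; rewrite zzJ.
apply: (IH _ _ _ zz10 zz20 _ _ _ _ run1 run2).
- by move=> t td; apply: ixJ; lia.
- by move=> t td; apply: zzJ; lia.
- move=> t z td zJ; rewrite !inE (SS t)//; last exact: leqW.
  case: (z \in S2) => //=; rewrite x12; case: (z _ == _) => //=.
  case: (boolP (fl d.+1)) => //= fld.
  have [z1S le1 min1] := f1 fld; have [z2S le2 min2] := f2 fld.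
  (* Both minimizers have the same pattern, so each competes in the other's run. Hence they tie in
     objective [d.+1], and either may serve as the threshold. *)
  have E1 : obj1 d.+1 (zz1 d.+1) <= obj1 d.+1 (zz2 d.+1).
    apply: min1; first by rewrite (SS d.+1).
      apply: contraNneq b2 => ->; rewrite x12//.
    by move=> k kd; rewrite (leE k d.+1) ?le2// ltnS kd leqnn.
  have E2 : obj2 d.+1 (zz2 d.+1) <= obj2 d.+1 (zz1 d.+1).
    apply: min2; first by rewrite -(SS d.+1).
      apply: contraNneq b1 => ->; rewrite x12//.
    by move=> k kd; rewrite -(leE k d.+1) ?le1// ltnS kd leqnn.
  have D1 : obj1 d.+1 (zz1 d.+1) - obj1 d.+1 (zz2 d.+1) =
      obj2 d.+1 (zz1 d.+1) - obj2 d.+1 (zz2 d.+1).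
    by apply: (diff d.+1 d.+1) => //; rewrite leqnn.
  have D2 := diff d.+1 t z (zz2 d.+1) _ zJ zJ2.
  rewrite -subr_lt0 -[RHS]subr_lt0 -D2; last by rewrite leqnn leqW.
  by congr (_ - _ < 0); lra.
- by move=> k t z z' tk; apply: diff; lia.
- by move=> k t z kt; apply: diffx; lia.
Qed.

End Witness.

(** * Guesses *)

Section Guess.
Variables (R : realFieldType) (d' n c : nat).
Local Notation d := d'.+1.
Local Notation coords := ('I_d * 'I_n)%type.
Local Notation marks := ('I_c * 'I_d)%type.
Variables (S : {set (cube n)}) (W : (cube n) -> R).
Implicit Types (u v : {ffun coords -> int}) (x z : (cube n)) (X : {ffun 'I_c -> (cube n)}).

Definition lin u (k : 'I_d) x : int := \sum_j u (k, j) * (x j)%:R.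

(** [insub] fails from index [d] on, so index [d] stands for [W]. *)
Definition int_objective u (k : nat) x : R :=
  if insub k is Some k' then (lin u k' x)%:~R else W x.

(** Strictness in [W] is the optimality that [witness_run_exists] starts from. *)
Definition strict_pareto u : {set (cube n)} :=
  [set x in S | [forall z in S, (z != x) ==>
    [forall k, lin u k z <= lin u k x] ==> (W x < W z)]].

(* For each of the [c] solutions, the positions at which its run branches, the
   branching flags, and the restrictions of the solutions the run visits to the
   set of all the positions. *)
Definition guess : finType :=
  ({ffun marks -> 'I_n} * {ffun marks -> bool} *
   {ffun 'I_c * 'I_d.+1 -> {ffun marks -> bool}})%type.

Definition pos (g : guess) (m : marks) : 'I_n := g.1.1 m.
Definition pattern (g : guess) (l : 'I_c) (t : nat) (m : marks) : bool :=
  g.2 (l, inord t) m.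

(** Mark [(l, t)] belongs to step [t.+1] of run [l], and steps are taken from [d] down to 1. So the
    last clause concerns the marks set before [m] and makes the pattern differences triangular. *)
Definition valid_guess (g : guess) : bool :=
  [&& injectiveb (pos g),
    [forall m : marks, pattern g m.1 m.2.+1 m != pattern g m.1 0 m] &
    [forall m : marks, forall m' : marks,
      (m'.1 < m.1)%N || (m'.1 == m.1) && (m.2 < m'.2)%N ==>
      (pattern g m.1 m.2.+1 m' == pattern g m.1 0 m')]].

Definition feasible_at (g : guess) (l : 'I_c) : {set (cube n)} :=
  [set z in S | [forall m : marks, (m.1 < l)%N ==> (z (pos g m) == pattern g l 0 m)]].

Definition runs u X (g : guess) : Prop := forall l, exists zz,
  [/\ witness_run (int_objective u) d (feasible_at g l) (X l)
        (fun t => pos g (l, inord t.-1)) (fun t => g.1.2 (l, inord t.-1)) zz,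
    zz 0%N = X l &
    forall t m, (t <= d)%N -> zz t (pos g m) = pattern g l t m].

(** The runs are made in the order of [l], each with the positions of the earlier ones fixed;
    [c * d <= n] leaves enough fresh positions. *)
Lemma runs_exist u X : (0 < n)%N -> (c * d <= n)%N ->
  (forall l, X l \in strict_pareto u) ->
  exists2 g, valid_guess g & runs u X g.
Proof.
move=> n0 cdn XP.
pose S_ (l : 'I_c) (J : {set 'I_n}) := [set z in S | [forall j in J, z j == X l j]].
(* Stating existence for every set [J] gives one choice function for the recursion that defines the
   sets [J l]. *)
have ex (lJ : 'I_c * {set 'I_n}) : exists r : (nat -> 'I_n) * (nat -> bool) * (nat -> (cube n)),
    (#|lJ.2| + d <= n)%N ->
    [/\ witness_run (int_objective u) d (S_ lJ.1 lJ.2) (X lJ.1) r.1.1 r.1.2 r.2,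
      r.2 0%N = X lJ.1,
      forall t, (t <= d)%N -> {in lJ.2, r.2 t =1 X lJ.1},
      forall t, (0 < t <= d)%N -> r.1.1 t \notin lJ.2 &
      forall t s, (t < s <= d)%N ->
        r.2 t (r.1.1 s) = X lJ.1 (r.1.1 s) /\ ((0 < t)%N -> r.1.1 t != r.1.1 s)].
  case: lJ => l J /=; have [cJ|cJ] := leqP (#|J| + d) n; last first.
    by exists ((fun=> Ordinal n0), xpred0, fun=> X l) => h; lia.
  have := XP l; rewrite inE => /andP[XS /forall_inP opt].
  have [||z|z|ix [fl [zz H]]] := @witness_run_exists R _ (int_objective u) d
      (S_ l J) (X l) J (Ordinal n0).
  - by rewrite card_ord.
  - by rewrite inE XS; apply/forall_inP => j _.
  - by rewrite inE => /andP[_ /forall_inP h] j /h/eqP.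
  - rewrite inE => /andP[zS _] zX le.
    have := opt z zS; rewrite zX /= => /implyP; rewrite /int_objective insubF ?ltnn//.
    apply; apply/forallP => k; have := le k (ltn_ord k).
    by rewrite /int_objective valK ler_int.
  - by exists (ix, fl, zz).
have [F HF] := choice ex.
pose fix J (l : nat) : {set 'I_n} :=
  if l is l'.+1 then
    if insub l' is Some lo then
      J l' :|: [set (F (lo, J l')).1.1 t.+1 | t : 'I_d] else J l'
  else finset.set0.
have JS (l : 'I_c) : J l.+1 = J l :|: [set (F (l, J l)).1.1 t.+1 | t : 'I_d].
  by rewrite /= valK.
have cJ l : (#|J l| <= l * d)%N.
  elim: l => [|l IH]; first by rewrite /= cards0.
  case: (ltnP l c) => lc; last first.
    by rewrite /= insubF ?(leq_trans IH)//; lia.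
  rewrite (JS (Ordinal lc)) /=; apply: leq_trans (leq_card_setU _ _) _.
  rewrite mulSn addnC leq_add//.
  by rewrite -[X in (_ <= X)%N](card_ord d); apply: leq_imset_card.
pose r (l : 'I_c) := F (l, J l).
have Hr (l : 'I_c) := HF (l, J l).
have {Hr} Hr (l : 'I_c) : [/\ witness_run (int_objective u) d (S_ l (J l)) (X l)
        (r l).1.1 (r l).1.2 (r l).2,
      (r l).2 0%N = X l,
      forall t, (t <= d)%N -> {in J l, (r l).2 t =1 X l},
      forall t, (0 < t <= d)%N -> (r l).1.1 t \notin J l &
      forall t s, (t < s <= d)%N -> (r l).2 t ((r l).1.1 s) = X l ((r l).1.1 s) /\
        ((0 < t)%N -> (r l).1.1 t != (r l).1.1 s)].
  apply: Hr; apply: leq_trans _ cdn; apply: leq_trans _ (leq_mul (ltn_ord l) (leqnn d)).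
  by rewrite mulSn addnC leq_add2l; apply: cJ.
pose ii : {ffun marks -> 'I_n} := [ffun m : marks => (r m.1).1.1 m.2.+1].
have JE l : (l <= c)%N -> forall a, reflect (exists2 m : marks, (m.1 < l)%N & a = ii m) (a \in J l).
  elim: l => [|l IH] lc a; first by rewrite inE; constructor; case.
  rewrite (JS (Ordinal lc)) inE; apply: (iffP orP) => /=.
    case=> [/(IH (ltnW lc))[m ml ->]|/imsetP[t _ ->]]; first by exists m; rewrite // leqW.
    by exists (Ordinal lc, t); rewrite // ffunE.
  case=> [[lo t] /=]; rewrite ltnS leq_eqVlt ffunE /= => /predU1P[E ->|ll ->].
    right; apply/imsetP; exists t => //.
    by have -> : lo = Ordinal lc by apply: val_inj.
  by left; apply/(IH (ltnW lc)); exists (lo, t); rewrite // ffunE.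
have ii_inj : injective ii.
  move=> [l t] [l' t']; rewrite !ffunE /=.
  have lt_neq (l1 l2 : 'I_c) (t1 t2 : 'I_d) : (l1 < l2)%N -> (r l1).1.1 t1.+1 != (r l2).1.1 t2.+1.
    move=> l12; have [_ _ _ h _] := Hr l2; have := h t2.+1 (ltn_ord t2).
    apply: contraNneq => <-; apply/JE; first exact: ltnW.
    by exists (l1, t1); rewrite // ffunE.
  case: (ltngtP l l') => [ll /eqP|ll /eqP|/val_inj ->].
  - by rewrite (negPf (lt_neq _ _ _ _ _)).
  - by rewrite eq_sym (negPf (lt_neq _ _ _ _ _)).
  have [_ _ _ _ h] := Hr l'.
  have tt_neq (t1 t2 : 'I_d) : (t1 < t2)%N -> (r l').1.1 t1.+1 != (r l').1.1 t2.+1.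
    by move=> t12; apply: (h t1.+1 t2.+1 _).2 => //; rewrite ltnS t12 ltn_ord.
  case: (ltngtP t t') => [tt /eqP|tt /eqP|/val_inj -> //].
  - by rewrite (negPf (tt_neq _ _ _)).
  - by rewrite eq_sym (negPf (tt_neq _ _ _)).
pose g : guess := (ii, [ffun m : marks => (r m.1).1.2 m.2.+1],
  [ffun lt : 'I_c * 'I_d.+1 => [ffun m : marks => (r lt.1).2 lt.2 (ii m)]]).
have gE l t m : (t <= d)%N -> pattern g l t m = (r l).2 t (ii m).
  by move=> td; rewrite /pattern /g /= !ffunE /= inordK.
have iiE l t : ii (l, t) = (r l).1.1 t.+1 by rewrite ffunE.
exists g.
  apply/and3P; split.
  - exact/injectiveP.
  - apply/forallP => -[l t] /=; rewrite !gE//.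
    have [run -> _ _ _] := Hr l; rewrite iiE.
    by apply: (witness_run_neq run); rewrite /= ltn_ord.
  - apply/forallP => -[l t]; apply/forallP => -[l' t'] /=; apply/implyP.
    rewrite !gE//; have [_ -> JX _ tri] := Hr l => /orP[ll|/andP[/eqP -> tt]].
      rewrite JX ?ltn_ord//; apply/JE; first exact: ltnW.
      by exists (l', t').
    by rewrite iiE (tri t.+1 t'.+1 _).1// ltnS tt ltn_ord.
move=> l; exists (r l).2; have [run X0 _ _ _] := Hr l; split=> //.
- have -> : feasible_at g l = S_ l (J l).
    apply/setP => z; rewrite !inE; congr (_ && _).
    apply/forallP/forall_inP => [h j /(JE l (ltnW (ltn_ord l)))[m ml ->]|h m].
      by have := h m; rewrite ml gE// X0.
    apply/implyP => ml; rewrite gE// X0; apply: h.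
    by apply/JE; [exact: ltnW|exists m].
  apply: witness_run_ext run => -[//|t] /= td.
  by rewrite /pos /g /= !ffunE /= inordK.
- by move=> t m td; rewrite gE.
Qed.

(* In objective [k] a run only compares solutions of a pattern [t <= k] with the
   solution visited at step [k], and solutions of a pattern [t > k] with the
   final solution. Measuring the latter relative to the pattern [d], i.e. by
   [target], leaves the following differences of patterns to be known. The
   index [t = k] is skipped. *)
Definition coef (g : guess) (q : 'I_d * 'I_c * 'I_d') (m : marks) : int :=
  let t := lift q.1.1 q.2 in
  (pattern g q.1.2 t m)%:R -
  (pattern g q.1.2 (if (q.1.1 < t)%N then d else q.1.1) m)%:R.

Definition comb (g : guess) (q : 'I_d * 'I_c * 'I_d') (i : coords) : int :=
  if i.1 == q.1.1 then \sum_(m | pos g m == i.2) coef g q m else 0.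

Definition target u X (g : guess) (k : 'I_d) (l : 'I_c) : int :=
  lin u k (X l) - \sum_m u (k, pos g m) * (pattern g l d m)%:R.

Definition marked (g : guess) : {set coords} :=
  finset.setX [set: 'I_d] [set pos g m | m : marks].

Lemma coef_le1 g q m : `|coef g q m| <= 1.
Proof. by rewrite /coef; do 2?case: pattern. Qed.

Lemma comb_le1 g q i : injective (pos g) -> `|comb g q i| <= 1.
Proof.
move=> g_inj; rewrite /comb; case: ifP => // _.
case: (pickP (fun m => pos g m == i.2)) => [m /eqP E|no]; last by rewrite big_pred0.
rewrite (bigD1 m) ?E//= big1 ?addr0 ?coef_le1// => m' /andP[/eqP E' /eqP].
by case; apply: g_inj; rewrite E E'.
Qed.

Lemma comb_sum g q u :
  \sum_i comb g q i * u i = \sum_m coef g q m * u (q.1.1, pos g m).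
Proof.
transitivity (\sum_k \sum_j comb g q (k, j) * u (k, j)).
  by rewrite pair_bigA; apply: eq_bigr => -[].
rewrite (bigD1 q.1.1)//= [X in _ + X]big1 ?addr0; last first.
  by move=> k /negPf kq; rewrite big1// => j _; rewrite /comb /= kq mul0r.
rewrite [RHS](partition_big (pos g) xpredT)//=; apply: eq_bigr => j _.
rewrite /comb eqxx /= mulr_suml; apply: eq_bigr => m /eqP <- //.
Qed.

Lemma card_marked g : injective (pos g) -> #|marked g| = (d * (c * d))%N.
Proof.
by move=> g_inj; rewrite cardsX cardsT card_ord card_imset// card_prod !card_ord.
Qed.

(** In the equation of mark [(l, t)] the marks set earlier drop out by validity and those set later
    by induction, which leaves [D (l, t)] times 1 or -1. *)
Lemma pattern_diff_basis g (D : marks -> int) : valid_guess g ->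
  (forall l (t : 'I_d), \sum_m D m * (pattern g l t.+1 m)%:R =
    \sum_m D m * (pattern g l 0 m)%:R) ->
  forall m, D m = 0.
Proof.
move=> /and3P[_ /forallP neq /forallP eq] hD.
suff key N (m : marks) : ((c - m.1.+1) * d + m.2 < N)%N -> D m = 0.
  by move=> m; apply: (key _.+1 m).
elim: N m => // N IH [l t] /= ltN.
have := hD l t; rewrite (bigD1 (l, t))//= [in RHS](bigD1 (l, t))//=.
have -> : \sum_(m | m != (l, t)) D m * (pattern g l t.+1 m)%:R =
    \sum_(m | m != (l, t)) D m * (pattern g l 0 m)%:R.
  apply: eq_bigr => -[l' t'] ne.
  have /forallP/(_ (l', t')) /= := eq (l, t).
  case: (boolP (_ || _)) => [_ /eqP -> //|]; rewrite negb_or negb_and -!leqNgt.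
  move=> /andP[ll tt] _; rewrite IH ?mul0r//=.
  have {}tt : (l < l')%N \/ (l' = l /\ (t' < t)%N).
    case/orP: tt => [ne'|tt]; first by left; rewrite ltn_neqAle eq_sym ne'.
    move: ll; rewrite leq_eqVlt => /predU1P[/val_inj E|]; [right|by left].
    split=> //; rewrite ltn_neqAle tt andbT.
    by apply: contraNneq ne => /val_inj ->; rewrite E.
  rewrite ltnS in ltN; apply: leq_trans ltN.
  case: tt => [ltl|[-> tt]]; last by rewrite ltn_add2l.
  have : ((c - l'.+1).+1 * d <= (c - l.+1) * d)%N.
    by rewrite leq_mul2r; have := ltn_ord l'; lia.
  by rewrite mulSn; have := ltn_ord t'; lia.
move/addIr => /eqP; rewrite -subr_eq0 -mulrBr mulf_eq0 => /predU1P[//|].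
by have := neq (l, t); rewrite /=; do 2?case: pattern.
Qed.

Lemma subr_swap (a b a' b' : int) : a - b = a' - b' -> a - a' = b - b'.
Proof. lia. Qed.

(** The agreeing data make all comparisons of the two runs agree, so [witness_run_unique] gives
    [X = Y]. Then [u - v] is orthogonal to the pattern differences, and [pattern_diff_basis] gives
    [u = v]. *)
Lemma runs_det u v X Y g : valid_guess g -> runs u X g -> runs v Y g ->
  (forall i, i \notin marked g -> u i = v i) ->
  (forall q, \sum_i comb g q i * u i = \sum_i comb g q i * v i) ->
  (forall k l, target u X g k l = target v Y g k l) ->
  X = Y /\ u = v.
Proof.
move=> vg ru rv off hq ht; have /and3P[/injectiveP g_inj _ _] := vg.
pose D k m := u (k, pos g m) - v (k, pos g m).
pose dot k l t := \sum_m D k m * (pattern g l t m)%:R.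
have linE k l t z : (forall m, z (pos g m) = pattern g l t m) ->
    lin u k z - lin v k z = dot k l t.
  move=> zE; rewrite /lin -sumrB (bigID (mem [set pos g m | m : marks]))/=.
  rewrite [X in _ + X]big1 ?addr0; last first.
    by move=> j jm; rewrite off ?subrr// inE /= negb_and jm orbT.
  rewrite big_imset/=; last by move=> m m' _ _; apply: g_inj.
  apply: eq_big => [m|m _]; first by rewrite !inE.
  by rewrite -mulrBl zE.
(* The combinations link the patterns up to [k] with one another, and those after [k] with pattern
   [d]. *)
have dotE k l t : (t <= d)%N -> dot k l t = dot k l (if (k < t)%N then d else k).
  move=> td; have [->|ntd] := eqVneq t d; first by rewrite ltn_ord.
  have {}td : (t < d)%N by lia.
  have [<-|ntk] := eqVneq (k : nat) t; first by rewrite ltnn.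
  case: (unliftP k (Ordinal td)) => [t' E|E]; last by rewrite -E eqxx in ntk.
  have := hq (k, l, t'); rewrite !comb_sum /coef /= -[bump k t']/(val (lift k t')) -E /= => /eqP.
  rewrite -subr_eq0 -sumrB => /eqP h; apply/eqP; rewrite -subr_eq0 -h.
  rewrite /dot -sumrB; apply/eqP/eq_bigr => m _.
  by rewrite /D; ring.
have targetE k l : lin u k (X l) - lin v k (Y l) = dot k l d.
  have := ht k l; rewrite /target => E.
  rewrite /dot; under eq_bigr do rewrite /D mulrBl.
  by rewrite sumrB; apply: subr_swap.
have XY : X = Y.
  apply/ffunP => l; have [z1 [run1 z10 z1E]] := ru l.
  have [z2 [run2 z20 z2E]] := rv l.
  have ipat t z : (t <= d)%N -> {in [set pos g m | m : marks], z =1 z1 t} ->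
      forall m, z (pos g m) = pattern g l t m.
    by move=> td zE m; rewrite zE ?z1E//; apply/imsetP; exists m.
  apply: (witness_run_unique (J := [set pos g m | m : marks]) _ z10 z20 _ _ _ _ run1 run2).
  - by move=> t _; apply/imsetP; exists (l, inord t.-1).
  - by move=> t td j /imsetP[m _ ->]; rewrite z1E// z2E.
  - by [].
  - move=> k t z z' /andP[tk kd] /ipat zE /ipat z'E; apply/eqP.
    rewrite /int_objective; case: insubP => [ko _ kE|_]; last by [].
    rewrite -!rmorphB/= eqr_int.
    have {}zE := linE ko l t z (zE (leq_trans tk kd)).
    have {}z'E := linE ko l k z' (z'E kd).
    have := dotE ko l t (leq_trans tk kd); rewrite kE ltnNge tk /= -kE in z'E *.
    by move=> E; apply/eqP/subr_swap; rewrite zE z'E.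
  - move=> k t z /andP[kt td] /ipat zE.
    rewrite /int_objective; case: insubP => [ko _ kE|]; last by rewrite -leqNgt; lia.
    rewrite -!rmorphB/=; apply/eqP; rewrite eqr_int.
    have {}zE := linE ko l t z (zE td).
    have := dotE ko l t td; rewrite kE kt => E.
    by apply/eqP/subr_swap; rewrite zE E targetE.
split=> //; apply/ffunP => -[k j].
case: (boolP ((k, j) \in marked g)) => [|/off //].
rewrite !inE /= => /imsetP[m _ ->]; apply/eqP; rewrite -subr_eq0 -/(D k m); apply/eqP.
apply: (pattern_diff_basis vg) => l t.
have [z1 [_ z10 z1E]] := ru l.
(* With [X = Y], computing the shift of [X l] from its pattern and from its target joins the two
   classes of patterns. *)
have d0d : dot k l 0 = dot k l d.
  have := targetE k l; rewrite -XY (linE k l 0%N)// => m'.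
  by rewrite -z10 z1E.
rewrite -/(dot k l t.+1) -/(dot k l 0) (dotE _ _ t.+1)//.
by case: ifP => _; [rewrite d0d|rewrite (dotE k l 0%N)].
Qed.

Lemma norm_lin_le (N : nat) u k x : (forall i, `|u i| <= N%:Z) ->
  `|lin u k x| <= (n * N)%:Z.
Proof.
move=> uN; apply: le_trans (ler_norm_sum _ _ _) _.
apply: (@le_trans _ _ (\sum_(j < n) N%:Z)).
  by apply: ler_sum => j _; have := uN (k, j); case: (x j); lia.
by rewrite sumr_const card_ord -mulr_natr; lia.
Qed.

Lemma norm_target_le (N : nat) u X g k l : (c * d <= n)%N ->
  (forall i, `|u i| <= N%:Z) -> `|target u X g k l| <= (2 * n * N)%:Z.
Proof.
move=> cdn uN; have := norm_lin_le k (X l) uN; rewrite /target.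
suff : `|\sum_m u (k, pos g m) * (pattern g l d m)%:R| <= (n * N)%:Z.
  by move: (lin _ _ _) (\sum_m _) => a b; lia.
apply: le_trans (ler_norm_sum _ _ _) _.
apply: (@le_trans _ _ (\sum_(m : marks) N%:Z)).
  by apply: ler_sum => m _; have := uN (k, pos g m); case: pattern; lia.
by rewrite sumr_const card_prod !card_ord -mulr_natr; nia.
Qed.

Lemma norm_comb_sum_le (N : nat) u g q : (forall i, `|u i| <= N%:Z) ->
  `|\sum_i comb g q i * u i| <= (c * d * N)%:Z.
Proof.
move=> uN; rewrite comb_sum; apply: le_trans (ler_norm_sum _ _ _) _.
apply: (@le_trans _ _ (\sum_(m : marks) N%:Z)).
  apply: ler_sum => m _; rewrite normrM.
  by have := uN (q.1.1, pos g m); have := coef_le1 g q m; nia.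
by rewrite sumr_const card_prod !card_ord -mulr_natr; lia.
Qed.

(** For [a = d'] and [b = c]: the marked coefficients outnumber the combinations by [c * d], the
    exponent in the variation bound. *)
Lemma mulnS_split (a b : nat) : (a.+1 * (b * a.+1) = a.+1 * b * a + b * a.+1)%N.
Proof. by nia. Qed.

Lemma inord_shift_inj (K : nat) (a b : int) :
  `|a| <= K%:Z -> `|b| <= K%:Z ->
  inord (absz (a + K%:Z)) = inord (absz (b + K%:Z)) :> 'I_(2 * K).+1 -> a = b.
Proof.
by move=> aK bK /(congr1 val) /=; rewrite !inordK; lia.
Qed.

Variables (p : coords -> int -> R) (N : nat) (box : seq {ffun coords -> int}).
Hypothesis p_submass : forall i, submass (p i).
Hypothesis box_uniq : uniq box.
Hypothesis box_le : forall u, u \in box -> forall i, `|u i| <= N%:Z.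
Hypothesis cdn : (c * d <= n)%N.

Let weight u := \prod_i p i (u i).

Let weight_ge0 u : 0 <= weight u.
Proof. by apply: prodr_ge0 => i _; apply: (p_submass i).1. Qed.

Definition determined (g : guess) (Om : seq {ffun coords -> int}) :=
  forall u v, u \in Om -> v \in Om -> (forall i, i \notin marked g -> u i = v i) ->
    (forall q, \sum_i comb g q i * u i = \sum_i comb g q i * v i) -> u = v.

(** Pairs [(u, X)] are sorted by their target values. For fixed values [runs_det] allows each [u] at
    most one tuple and makes the occurring [u] a determined list. *)
Lemma sum_runs_le (G : R) g : valid_guess g ->
  (forall Om, uniq Om -> {subset Om <= box} -> determined g Om ->
    \sum_(u <- Om) weight u <= G) ->
  \sum_(u <- box) weight u * #|[set X | `[< runs u X g >]]|%:R
    <= (2 * (2 * n * N)).+1%:R ^+ (d * c) * G.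
Proof.
move=> vg hG.
pose code u X : {ffun 'I_d * 'I_c -> 'I_(2 * (2 * n * N)).+1} :=
  [ffun kl => inord (absz (target u X g kl.1 kl.2 + (2 * n * N)%:Z)%R)].
pose D u := [set X | `[< runs u X g >]].
have code_eq u v X Y : u \in box -> v \in box -> code u X = code v Y ->
    forall k l, target u X g k l = target v Y g k l.
  move=> ub vb /ffunP E k l; have := E (k, l); rewrite !ffunE /=.
  by apply: inord_shift_inj; apply: norm_target_le => //; apply: box_le.
have cardD u : u \in box -> #|D u|%:R = \sum_b (b \in code u @: D u)%:R :> R.
  move=> ub; rewrite -(@card_in_imset _ _ (code u)); last first.
    move=> X Y; rewrite !inE => rX rY /(code_eq _ _ _ _ ub ub) E.
    by have [] := runs_det vg rX rY _ _ E.
  by rewrite -sum1_card big_mkcond natr_sum; apply: eq_bigr => b _; case: (_ \in _).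
rewrite big_seq; under eq_bigr => u ub do rewrite (cardD u ub) mulr_sumr.
rewrite -big_seq exchange_big/=.
apply: (@le_trans _ _ (\sum_(b : {ffun 'I_d * 'I_c -> 'I_(2 * (2 * n * N)).+1}) G)).
  apply: ler_sum => b _.
  rewrite (_ : \sum_(u <- box) _ = \sum_(u <- [seq u <- box | b \in code u @: D u]) weight u).
    apply: hG; [exact: filter_uniq|by move=> u; rewrite mem_filter => /andP[]|].
    move=> u v; rewrite !mem_filter => /andP[/imsetP[X XD bX] ub] /andP[/imsetP[Y YD bY] vb].
    move: XD YD; rewrite !inE => rX rY off hq.
    by have [] := runs_det vg rX rY off hq (code_eq _ _ _ _ ub vb (etrans (esym bX) bY)).
  rewrite big_filter [RHS]big_mkcond; apply: eq_bigr => u _.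
  by case: (_ \in _); rewrite ?mulr1 ?mulr0.
by rewrite sumr_const card_ffun card_prod !card_ord -natrX mulr_natl.
Qed.

Lemma sum_strict_pareto_le (G : R) : (0 < n)%N -> 0 <= G ->
  (forall g Om, valid_guess g -> uniq Om -> {subset Om <= box} ->
    determined g Om -> \sum_(u <- Om) weight u <= G) ->
  \sum_(u <- box) weight u * (#|strict_pareto u| ^ c)%:R
    <= #|guess|%:R * ((2 * (2 * n * N)).+1%:R ^+ (d * c) * G).
Proof.
move=> n0 G0 hG.
apply: (@le_trans _ _ (\sum_(u <- box) weight u *
    \sum_(g | valid_guess g) #|[set X | `[< runs u X g >]]|%:R)).
  apply: ler_sum => u _; apply: ler_wpM2l; first exact: weight_ge0.
  rewrite -natr_sum ler_nat -{1}(card_ord c) -card_ffun_on.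
  apply: (@leq_trans #|\bigcup_(g | valid_guess g) [set X | `[< runs u X g >]]|).
    apply/subset_leq_card/fintype.subsetP => X /ffun_onP XP.
    have [g vg rg] := runs_exist n0 cdn XP.
    by apply/finset.bigcupP; exists g => //; rewrite inE; apply/asboolP.
  apply: (big_rec2 (fun (A : {set {ffun 'I_c -> (cube n)}}) m => #|A| <= m)%N).
    by rewrite cards0.
  move=> g m A _ IH.
  by apply: leq_trans (leq_card_setU _ _) _; rewrite leq_add2l.
under eq_bigr do rewrite mulr_sumr.
rewrite exchange_big/=.
apply: (@le_trans _ _ (\sum_(g | valid_guess g)
    ((2 * (2 * n * N)).+1%:R ^+ (d * c) * G))).
  apply: ler_sum => g vg; apply: sum_runs_le => // Om; exact: hG.
rewrite sumr_const -[leLHS]mulr_natl ler_wpM2r ?ler_nat ?max_card//.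
by rewrite mulr_ge0// exprn_ge0.
Qed.

(** Within a class of equal values of the [d * c * d'] combinations, the unmarked coefficients
    determine [u], and each marked one costs [M]. *)
Lemma sum_determined_general (M : R) g Om : valid_guess g ->
  (forall i a, p i a <= M) -> uniq Om -> {subset Om <= box} -> determined g Om ->
  \sum_(u <- Om) weight u <=
    (2 * (c * d * N)).+1%:R ^+ (d * c * d') * M ^+ (d * (c * d)).
Proof.
move=> vg pM uOm sub det; have /and3P[/injectiveP g_inj _ _] := vg.
pose code u : {ffun 'I_d * 'I_c * 'I_d' -> 'I_(2 * (c * d * N)).+1} :=
  [ffun q => inord (absz ((\sum_i comb g q i * u i) + (c * d * N)%:Z)%R)].
rewrite (partition_big code xpredT)//=.
apply: (@le_trans _ _ (\sum_(b : {ffun 'I_d * 'I_c * 'I_d' -> 'I_(2 * (c * d * N)).+1})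
    M ^+ (d * (c * d)))); last first.
  by rewrite sumr_const card_ffun !card_prod !card_ord -natrX mulr_natl.
apply: ler_sum => b _; rewrite -big_filter -(card_marked g_inj).
apply: submass_prod_det => //; first exact: filter_uniq.
move=> u v; rewrite !mem_filter => /andP[/eqP ub uO] /andP[/eqP vb vO] off.
apply: det => // q; have /ffunP/(_ q) := etrans ub (esym vb); rewrite !ffunE.
by apply: inord_shift_inj; apply: norm_comb_sum_le; apply: box_le; apply: sub.
Qed.

Lemma sum_determined_variation (b : R) g Om : valid_guess g -> 0 < b ->
  (forall i, variation_le b (p i)) -> (forall i, bounded_support (p i)) ->
  uniq Om -> determined g Om ->
  \sum_(u <- Om) weight u <=
    (((d * c * d').+1 * (2 * (d * c * d') + 3) ^ (d * c * d'))%:R * b) ^+ (c * d).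
Proof.
move=> vg b0 vp sp uOm det; have /and3P[/injectiveP g_inj _ _] := vg.
have cQ : #|{: 'I_d * 'I_c * 'I_d'}| = (d * c * d')%N by rewrite !card_prod !card_ord.
rewrite -cQ; apply: (@submass_prod_variation _ _ _ (comb g) _ b0 _ _ (marked g)) => //.
- by move=> q i; apply: comb_le1.
- by rewrite card_marked// cQ mulnS_split.
Qed.

End Guess.

(** * Weighted sums over rounded coefficients *)

Section Discrete.
Variables (R : realFieldType) (d' n c : nat).
Local Notation d := d'.+1.
Local Notation coords := ('I_d * 'I_n)%type.
Variables (S : {set (cube n)}) (W : (cube n) -> R).
Implicit Types (u v : {ffun coords -> int}) (x z : (cube n)).

(* Rounding moves the scaled value of a solution by at most [n], so a gap above
   [2 * n] keeps its sign. *)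
Definition near_tie u : bool :=
  [exists k : 'I_d, exists z : (cube n), exists z' : (cube n),
    (z != z') && (`|lin u k z - lin u k z'| <= (2 * n)%:Z)].

Lemma lin_diff_det u v (k : 'I_d) (j : 'I_n) z z' : z j != z' j ->
  (forall i, i != (k, j) -> u i = v i) ->
  lin u k z - lin u k z' = lin v k z - lin v k z' -> u = v.
Proof.
move=> zj off E; apply/ffunP => i; have [->|/off//] := eqVneq i (k, j).
move: E; rewrite /lin -!sumrB !(bigD1 (P := xpredT) j)//=.
have -> : \sum_(j' | j' != j) (u (k, j') * (z j')%:R - u (k, j') * (z' j')%:R) =
  \sum_(j' | j' != j) (v (k, j') * (z j')%:R - v (k, j') * (z' j')%:R).
  by apply: eq_bigr => j' /negPf j'j; rewrite !off// xpair_eqE j'j andbF.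
by move/addIr; move: zj; case: (z j); case: (z' j); rewrite ?mulr1 ?mulr0 ?subr0 ?sub0r// => _ /oppr_inj.
Qed.

(** Union bound over the objective, the pair and the exact value of its difference, one of
    [4 * n + 1]. That value determines the coefficient at a position where the pair differs from the
    other coefficients. *)
Lemma sum_near_tie_le (p : coords -> int -> R) (M : R) (box : seq {ffun coords -> int}) :
  (forall i, submass (p i)) -> uniq box -> 0 <= M -> (forall i a, p i a <= M) ->
  \sum_(u <- box) (\prod_i p i (u i)) * (near_tie u)%:R
    <= (d * (2 ^ n * (2 ^ n * (4 * n).+1)))%:R * M.
Proof.
move=> hp ubox M0 pM; pose wt u := \prod_i p i (u i).
have wt0 u : 0 <= wt u by apply: prodr_ge0 => i _; apply: (hp i).1.
pose E := ('I_d * ((cube n) * ((cube n) * 'I_(4 * n).+1)))%type.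
pose ev (e : E) u := (e.2.1 != e.2.2.1) &&
  (lin u e.1 e.2.1 - lin u e.1 e.2.2.1 == (e.2.2.2 : nat)%:Z - (2 * n)%:Z).
apply: (@le_trans _ _ (\sum_(u <- box) \sum_(e : E) wt u * (ev e u)%:R)).
  apply: ler_sum => u _; rewrite -/(wt u) -mulr_sumr ler_wpM2l//.
  case: (boolP (near_tie u)) => [|_]; last exact: sumr_ge0.
  case/existsP=> k /existsP[z /existsP[z' /andP[zz' tie]]].
  have ltn : (absz (lin u k z - lin u k z' + (2 * n)%:Z)%R < (4 * n).+1)%N.
    by move: tie; move: (lin u k z - _) => a; lia.
  rewrite (bigD1 (k, (z, (z', Ordinal ltn))))//= {1}/ev /= zz' /=.
  rewrite (_ : (_ == _) = true) ?lerDl ?sumr_ge0//.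
  by apply/eqP; move: tie; move: (lin u k z - _) => a; lia.
rewrite exchange_big/=; apply: (@le_trans _ _ (\sum_(e : E) M)); last first.
  by rewrite sumr_const !card_prod !card_ffun !card_ord card_bool mulr_natl.
apply: ler_sum => -[k [z [z' a]]] _.
have [->|zz'] := eqVneq z z'.
  by rewrite big1// => u _; rewrite /ev /= eqxx mulr0.
have [j zj] : exists j, z j != z' j.
  apply/existsP; apply: contraNT zz'; rewrite negb_exists => /forallP h.
  by apply/eqP/ffunP => j; apply/eqP; have := h j; rewrite negbK.
rewrite (_ : \sum_(u <- box) _ = \sum_(u <- [seq u <- box | ev (k, (z, (z', a))) u]) wt u); last first.
  rewrite big_filter [RHS]big_mkcond; apply: eq_bigr => u _.
  by case: ev; rewrite ?mulr1 ?mulr0.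
rewrite -[M in leRHS]expr1 -[X in M ^+ X](cards1 (k, j)).
apply: submass_prod_det => //; first exact: filter_uniq.
move=> u v; rewrite !mem_filter /ev /= => /andP[/andP[_ /eqP uE] _] /andP[/andP[_ /eqP vE] _] off.
apply: (lin_diff_det (k := k) zj) => [i ij|]; last by rewrite uE vE.
by apply: off; rewrite finset.in_set1.
Qed.

Definition guess_factor : nat := (2 ^ (c * d) * (2 ^ (c * d)) ^ (c * d.+1))%N.

Lemma card_guess : #|guess d' n c| = (n ^ (c * d) * guess_factor)%N.
Proof.
rewrite /guess !card_prod !card_ffun !card_prod !card_ord card_bool /guess_factor.
by rewrite mulnA.
Qed.

(** Positions give [n ^ (c * d)], target values [(5 n N) ^ (c * d)] and the section bound
    [(4 C phi / N) ^ (c * d)]: [N] cancels, and [20 = 5 * 4]. *)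
Lemma sum_strict_pareto_variation (p : coords -> int -> R) (N : nat) (phi : R)
    (box : seq {ffun coords -> int}) :
  (0 < n)%N -> (0 < N)%N -> 0 < phi -> (c * d <= n)%N ->
  (forall i, submass (p i)) -> (forall i, bounded_support (p i)) ->
  (forall i, variation_le (4 * phi / N%:R) (p i)) ->
  uniq box -> (forall u, u \in box -> forall i, `|u i| <= N%:Z) ->
  \sum_(u <- box) (\prod_i p i (u i)) * (#|strict_pareto S W u| ^ c)%:R <=
    guess_factor%:R * (20 * ((d * c * d').+1 * (2 * (d * c * d') + 3) ^ (d * c * d'))%:R) ^+ (c * d)
     * (n%:R ^+ (2 * d) * phi ^+ d) ^+ c.
Proof.
move=> n0 N0 phi0 cdn hp sp vp ubox box_le.
set C : R := (_ * _)%:R.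
have C0 : 0 <= C by rewrite ler0n.
have NR : 0 < N%:R :> R by rewrite ltr0n.
have nR : 0 < n%:R :> R by rewrite ltr0n.
have b0 : 0 < 4 * phi / N%:R by rewrite divr_gt0// mulr_gt0.
have Cb0 : 0 <= C * (4 * phi / N%:R) by rewrite mulr_ge0// ltW.
have nN0 : 0 <= 5 * n%:R * N%:R :> R by rewrite !mulr_ge0.
have G0 : 0 <= (C * (4 * phi / N%:R)) ^+ (c * d) by apply: exprn_ge0.
apply: le_trans (@sum_strict_pareto_le _ _ _ _ S W p N box hp ubox box_le cdn _ n0 G0 _) _.
  move=> g Om vg uOm _ det.
  exact: (sum_determined_variation hp vg b0 vp sp uOm det).
rewrite card_guess natrM natrX [(d * c)%N]mulnC.
have N5 : (2 * (2 * n * N)).+1%:R <= 5 * n%:R * N%:R :> R.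
  by rewrite -!natrM ler_nat; nia.
rewrite -exprMn.
apply: (@le_trans _ _ (n%:R ^+ (c * d) * guess_factor%:R *
    (5 * n%:R * N%:R * (C * (4 * phi / N%:R))) ^+ (c * d))).
  rewrite ler_wpM2l ?mulr_ge0 ?exprn_ge0// lerXn2r ?nnegrE//.
  - exact: mulr_ge0.
  - exact: mulr_ge0.
  - exact: ler_wpM2r.
rewrite (_ : 5 * n%:R * N%:R * (C * (4 * phi / N%:R)) = 20 * C * (n%:R * phi)); last first.
  by field; rewrite gt_eqF.
rewrite le_eqVlt; apply/orP; left; apply/eqP.
rewrite (_ : (n%:R ^+ (2 * d) * phi ^+ d) ^+ c = n%:R ^+ (c * d) * (n%:R * phi) ^+ (c * d)).
  by rewrite exprMn; ring.
rewrite exprMn -!exprM exprMn mulrA -exprD; congr (_ ^+ _ * _ ^+ _); nia.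
Qed.

(** Target values and combinations contribute [N ^ (d * c + d * c * d')], which the [d * (c * d)]
    factors [phi / N] cancel. *)
Lemma sum_strict_pareto_general (p : coords -> int -> R) (N : nat) (phi : R)
    (box : seq {ffun coords -> int}) :
  (0 < n)%N -> (0 < N)%N -> 1 <= phi -> (c * d <= n)%N ->
  (forall i, submass (p i)) -> (forall i a, p i a <= phi / N%:R) ->
  uniq box -> (forall u, u \in box -> forall i, `|u i| <= N%:Z) ->
  \sum_(u <- box) (\prod_i p i (u i)) * (#|strict_pareto S W u| ^ c)%:R <=
    guess_factor%:R * (5 ^+ (d * c) * (2 * (c * d) + 1)%:R ^+ (d * c * d'))
     * (n%:R ^+ (2 * d) * phi ^+ (d * (d + 1))) ^+ c.
Proof.
move=> n0 N0 phi1 cdn hp pM ubox box_le.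
have phi0 : 0 < phi by apply: lt_le_trans phi1.
have NR : 0 < N%:R :> R by rewrite ltr0n.
have nR : 0 < n%:R :> R by rewrite ltr0n.
have G0 : 0 <= (2 * (c * d * N)).+1%:R ^+ (d * c * d') * (phi / N%:R) ^+ (d * (c * d)).
  by rewrite mulr_ge0// exprn_ge0// divr_ge0// ltW.
apply: le_trans (@sum_strict_pareto_le _ _ _ _ S W p N box hp ubox box_le cdn _ n0 G0 _) _.
  move=> g Om vg uOm sub det.
  exact: (sum_determined_general hp box_le vg pM uOm sub det).
rewrite card_guess natrM natrX.
have N5 : (2 * (2 * n * N)).+1%:R <= 5 * n%:R * N%:R :> R.
  by rewrite -!natrM ler_nat; nia.
have N6 : (2 * (c * d * N)).+1%:R <= (2 * (c * d) + 1)%:R * N%:R :> R.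
  by rewrite -!natrM ler_nat; nia.
apply: (@le_trans _ _ (n%:R ^+ (c * d) * guess_factor%:R * ((5 * n%:R * N%:R) ^+ (d * c) *
   (((2 * (c * d) + 1)%:R * N%:R) ^+ (d * c * d') * (phi / N%:R) ^+ (d * (c * d)))))).
  rewrite ler_wpM2l ?mulr_ge0 ?exprn_ge0//.
  apply: ler_pM; [exact: exprn_ge0|exact: G0| |].
    by apply: lerXn2r; rewrite ?nnegrE// !mulr_ge0.
  apply: ler_wpM2r; first by rewrite exprn_ge0// divr_ge0// ltW.
  by apply: lerXn2r; rewrite ?nnegrE// !mulr_ge0.
rewrite (_ : _ * guess_factor%:R * _ =
   guess_factor%:R * (5 ^+ (d * c) * (2 * (c * d) + 1)%:R ^+ (d * c * d')) *
   (n%:R ^+ (2 * d * c) * phi ^+ (d * (c * d)))); last first.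
  have -> : (d * (c * d) = d * c + d * c * d')%N by nia.
  have -> : (2 * d * c = c * d + d * c)%N by nia.
  rewrite !exprMn !exprD !exprVn; field.
  by rewrite !expf_neq0// gt_eqF.
rewrite exprMn -!exprM; apply: ler_wpM2l.
  by apply: mulr_ge0 => //; apply: mulr_ge0; apply: exprn_ge0.
apply: ler_wpM2l; first exact: exprn_ge0.
(* The exponent obtained is [d * (c * d)]; as [1 <= phi], it may be raised to [d * (d + 1) * c]. *)
by apply: ler_weXn2l => //; nia.
Qed.

End Discrete.

(** * Rounding *)

Section Expectation.
Local Open Scope classical_set_scope.
Context {R : realType} {disp : measure_display} {T : measurableType disp}.

(** The integral is a supremum over simple functions below the integrand, hence monotone without
    measurability. This spares a proof that the Pareto count is measurable. *)
Lemma ge0_integral_mono (mu : {measure set T -> \bar R}) (f g : T -> \bar R) :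
  (forall x, 0 <= f x)%E -> (forall x, f x <= g x)%E ->
  (\int[mu]_x f x <= \int[mu]_x g x)%E.
Proof.
move=> f0 fg; rewrite !ge0_integralTE//; last by move=> x; apply: le_trans (fg x).
apply: le_ereal_sup => _ [h /= hf <-]; exists h => //= x.
exact: le_trans (fg x).
Qed.

Lemma expectation_le_sum (P : probability T R) (X : T -> R) (K : Type)
    (s : seq K) (a : K -> R) (A : K -> set T) :
  (forall k, measurable (A k)) -> (forall k, 0 <= a k) -> (forall w, 0 <= X w) ->
  (forall w, X w <= \sum_(k <- s) a k * \1_(A k) w) ->
  ('E_P[X] <= \sum_(k <- s) (a k)%:E * P (A k))%E.
Proof.
move=> mA a0 X0 XA; rewrite expectation.unlock.
apply: le_trans (@ge0_integral_mono P _
    (fun w => \sum_(k <- s) (a k * \1_(A k) w)%:E)%E _ _) _.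
  - by move=> w; rewrite lee_fin.
  - by move=> w; rewrite sumEFin lee_fin.
rewrite ge0_integral_sum//; first last.
- by move=> k w _; rewrite lee_fin mulr_ge0.
- by move=> k; apply/measurable_EFinP; apply: measurable_funM.
apply: lee_sum => k _; rewrite (integralZl_indic _ (fun=> A k))//.
  by rewrite integral_indic// setIT.
by rewrite ltNge a0.
Qed.

End Expectation.

(** The rising and the falling part telescope to at most [M] each. The steps starting at [m - 1] and
    [m] have unknown direction and cost at most [M] each. *)
Lemma unimodal_variation_le (R : realFieldType) (p : int -> R) (M : R) (m : int) :
  (forall a, 0 <= p a <= M) ->
  (forall a, a + 1 < m -> p a <= p (a + 1)) ->
  (forall a, m < a -> p (a + 1) <= p a) -> variation_le (4 * M) p.
Proof.
move=> pM incr decr s us; pose F a := `|p (a + 1) - p a|.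
pose K := (\max_(a <- s) `|a - m|)%N.
pose e (j : nat) : int := m - 1 - K%:Z + j%:Z.
have FM a : F a <= M.
  by have := pM a; have := pM (a + 1); rewrite /F ler_norml; lra.
have eS j : e j + 1 = e j.+1 by rewrite /e; lia.
apply: (@le_trans _ _ (\sum_(a <- [seq e j | j <- index_iota 0 (K + (2 + K))]) F a)).
  apply: ler_sum_sub => // [|a aS].
    by rewrite map_inj_uniq ?iota_uniq// => j j'; rewrite /e; lia.
  have := leq_bigmax_seq (P := xpredT) (F := fun a => `|a - m|%N) a aS isT.
  rewrite -/K => aK; apply/mapP; exists (absz (a - (m - 1 - K%:Z))%R).
    by rewrite mem_index_iota; lia.
  by rewrite /e; lia.
rewrite big_map (big_cat_nat (n := K))//=; last by lia.
rewrite [X in _ + X](big_cat_nat (n := (K + 2)%N))//=; try lia.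
have -> : 4 * M = M + (M *+ 2 + M) by ring.
apply: lerD; last apply: lerD.
- under eq_big_nat => j /andP[_ jK].
    rewrite /F ger0_norm; last first.
      by rewrite subr_ge0 incr//; rewrite /e; lia.
    rewrite eS; over.
  rewrite (telescope_sumr (fun j => p (e j)))//.
  by have := pM (e K); have := pM (e 0%N); lra.
- apply: (@le_trans _ _ (\sum_(K <= j < K + 2) M)); first exact: ler_sum.
  by rewrite sumr_const_nat addKn.
- under eq_big_nat => j /andP[jK _].
    rewrite /F ler0_norm; last first.
      by rewrite subr_le0 decr//; rewrite /e; lia.
    rewrite eS; over.
  rewrite sumrN (telescope_sumr (fun j => p (e j))); last by lia.
  by have := pM (e (K + (2 + K))%N); have := pM (e (K + 2)%N); lra.
Qed.

(** * Cell masses of a smooth density *)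

Section CellMass.
Local Open Scope classical_set_scope.
Variables (R : realType) (N : nat).
Hypothesis N_gt0 : (0 < N)%N.

Definition cell (a : int) : set R := `[a%:~R / N%:R, (a + 1)%:~R / N%:R[.

Lemma cellP a x : cell a x <-> a%:~R <= x * N%:R < (a + 1)%:~R.
Proof.
have NR : 0 < N%:R :> R by rewrite ltr0n.
by rewrite /cell /= in_itv /= ler_pdivrMr// ltr_pdivlMr.
Qed.

Lemma mem_cell_floor x : cell (Num.floor (x * N%:R)) x.
Proof. by apply/cellP; rewrite floor_itv. Qed.

Lemma cell_inj a b x : cell a x -> cell b x -> a = b.
Proof.
move=> /cellP/andP[a1 a2] /cellP/andP[b1 b2].
have := le_lt_trans a1 b2; have := le_lt_trans b1 a2.
by rewrite !ltr_int; lia.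
Qed.

Lemma measurable_cell a : measurable (cell a).
Proof. exact: measurable_itv. Qed.

Lemma lebesgue_measure_cell a : lebesgue_measure (cell a) = (N%:R^-1)%:E :> \bar R.
Proof.
have NR : 0 < N%:R :> R by rewrite ltr0n.
rewrite lebesgue_measure_itv /= lte_fin ltr_pM2r ?invr_gt0// ltr_int ltrDl ltr01.
by rewrite -EFinD -mulrBl -rmorphB/= addrAC subrr add0r mul1r.
Qed.

Section Law.
Variables (phi : R) (f : R -> R).
Hypothesis f_density : smooth_density phi f.
Context {disp : measure_display} {T : measurableType disp}.
Variables (P : probability T R) (X : {RV P >-> R}).
Hypothesis X_drawn : drawn_from X f.

Definition cell_mass (a : int) : R := fine (P (X @^-1` cell a)).

Lemma measurable_preimage_cell a : measurable (X @^-1` cell a).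
Proof. by rewrite -[_ @^-1` _]setTI; apply: measurable_funP => //; exact: measurable_cell. Qed.

Lemma EFin_cell_mass a : (cell_mass a)%:E = P (X @^-1` cell a).
Proof. by rewrite fineK// fin_num_measure//; apply: measurable_preimage_cell. Qed.

Lemma cell_mass_integral a : (cell_mass a)%:E =
  (\int[lebesgue_measure]_(x in cell a `&` `[(-1)%R, 1%R]) (f x)%:E)%E.
Proof. by rewrite EFin_cell_mass -X_drawn//; exact: measurable_cell. Qed.

Lemma cell_mass_submass : submass cell_mass.
Proof.
split=> [a|s us]; first by rewrite -lee_fin EFin_cell_mass.
rewrite -lee_fin -sumEFin; under eq_bigr do rewrite EFin_cell_mass.
rewrite fsbig_seq// -measure_fin_bigcup//.
- apply: probability_le1; apply: fin_bigcup_measurable => // a _.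
  exact: measurable_preimage_cell.
- by move=> a b _ _ [w [aw bw]]; apply: cell_inj aw bw.
- by move=> a _; apply: measurable_preimage_cell.
Qed.

Lemma measurable_density (D : set R) : measurable D -> D `<=` `[-1, 1] ->
  measurable_fun D (fun x => (f x)%:E).
Proof.
move=> mD D1; apply/measurable_EFinP; apply: measurable_funS D1 _ => //.
by have [] := f_density.
Qed.

Lemma density_ge0 x : -1 <= x <= 1 -> 0 <= f x <= phi.
Proof. by have [_ h _] := f_density => x1; apply: h; rewrite in_itv. Qed.

Lemma measurable_cell_trunc a : measurable (cell a `&` `[-1, 1] : set R).
Proof. by apply: measurableI => //; exact: measurable_cell. Qed.

Lemma cell_mass_le (y : R) a :
  (forall x, cell a x -> -1 <= x <= 1 -> f x <= y) -> 0 <= y ->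
  cell_mass a <= y / N%:R.
Proof.
move=> fy y0; rewrite -lee_fin cell_mass_integral.
apply: (@le_trans _ _ (\int[lebesgue_measure]_(x in cell a `&` `[(-1)%R, 1%R]) cst y%:E x)%E).
  apply: ge0_le_integral => //.
  - exact: measurable_cell_trunc.
  - by move=> x [_ /=]; rewrite in_itv /= => /density_ge0 /andP[]; rewrite lee_fin.
  - by apply: measurable_density; [exact: measurable_cell_trunc|move=> x []].
  - by move=> x [cx /=]; rewrite in_itv /= lee_fin; apply: fy.
rewrite integral_cst; last exact: measurable_cell_trunc.
rewrite EFinM -(lebesgue_measure_cell a); apply: lee_wpmul2l; first by rewrite lee_fin.
by apply: le_measure; rewrite ?inE; [exact: measurable_cell_trunc|exact: measurable_cell|move=> x []].
Qed.

Lemma cell_mass_ge (y : R) a : cell a `<=` `[-1, 1] ->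
  (forall x, cell a x -> y <= f x) -> 0 <= y -> y / N%:R <= cell_mass a.
Proof.
move=> a1 fy y0; rewrite -lee_fin cell_mass_integral (setIidl a1).
apply: (@le_trans _ _ (\int[lebesgue_measure]_(x in cell a) cst y%:E x)%E).
  by rewrite integral_cst ?EFinM -?(lebesgue_measure_cell a)//; exact: measurable_cell.
apply: ge0_le_integral => //.
- exact: measurable_cell.
- by apply: measurable_density => //; exact: measurable_cell.
Qed.

Lemma cell_mass_ge0 a : 0 <= cell_mass a.
Proof. by have [] := cell_mass_submass. Qed.

Lemma density_bound_ge0 : 0 <= phi.
Proof.
have := @density_ge0 0; rewrite lerN10 ler01 => /(_ isT) /andP[].
exact: le_trans.
Qed.

Lemma cell_mass_le_phi a : cell_mass a <= phi / N%:R.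
Proof.
apply: cell_mass_le; last exact: density_bound_ge0.
by move=> x _ /density_ge0 /andP[].
Qed.

Lemma cell_mass_eq0 a : (N < `|a|)%N -> cell_mass a = 0.
Proof.
move=> Na; apply/eqP; rewrite eq_le cell_mass_ge0 andbT.
have NR : 0 < N%:R :> R by rewrite ltr0n.
rewrite -(mul0r (N%:R^-1)); apply: cell_mass_le => // x /cellP/andP[ax xa] /andP[x1 x2].
have : - N%:R <= x * N%:R <= N%:R by apply/andP; split; nra.
case/andP => l r; have := le_trans ax r; have := le_lt_trans l xa.
by rewrite -[N%:R]/(N%:Z%:~R) -rmorphN /= ltr_int ler_int; lia.
Qed.

(** Cells [a] and [a + 1] share the endpoint [y a]. If both lie on one side of the mode, [f (y a)]
    separates the values of [f] on them, so the masses are ordered and [unimodal_variation_le]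
    applies. *)
Lemma cell_mass_variation : quasiconcave f ->
  variation_le (4 * phi / N%:R) cell_mass.
Proof.
case=> x0 [+ incr decr]; rewrite in_itv /= => /andP[x01 x02].
have NR : 0 < N%:R :> R by rewrite ltr0n.
have intD (a : int) : (a + 1)%:~R = a%:~R + 1 :> R by rewrite rmorphD.
have NZ : N%:Z%:~R = N%:R :> R by [].
have le_of_mulN (x y : R) : (x * N%:R <= y * N%:R) = (x <= y) by rewrite ler_pM2r.
pose y (a : int) : R := (a + 1)%:~R / N%:R.
have yN a : y a * N%:R = (a + 1)%:~R by rewrite divfK// gt_eqF.
rewrite -mulrA; apply: (@unimodal_variation_le _ _ _ (Num.floor (x0 * N%:R))).
- by move=> a; rewrite cell_mass_ge0 cell_mass_le_phi.
- move=> a am; have [Na|Na] := ltP a (- N%:Z).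
    by rewrite (@cell_mass_eq0 a) ?cell_mass_ge0//; lia.
  have yx0 : (a + 1 + 1)%:~R <= x0 * N%:R.
    by apply: le_trans (floor_le _); rewrite ler_int lezD1.
  have Na' : (- N%:Z)%:~R <= a%:~R :> R by rewrite ler_int.
  rewrite !intD in yx0; rewrite rmorphN /= NZ in Na'.
  have y1 : -1 <= y a <= x0.
    by apply/andP; split; rewrite -le_of_mulN yN intD; lra.
  have yI : y a \in (`[-1, x0])%R by rewrite in_itv.
  have /andP[y0 _] : 0 <= f (y a) <= phi by apply: density_ge0; lra.
  apply: (@le_trans _ _ (f (y a) / N%:R)).
    apply: cell_mass_le => // x /cellP/andP[ax xa] /andP[x1 x2].
    have xy : x <= y a by rewrite -le_of_mulN yN ltW.
    by apply: incr => //; rewrite in_itv /= x1 /=; lra.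
  have cx x : cell (a + 1) x -> y a <= x <= x0.
    move=> /cellP/andP[ax xa]; apply/andP; split; rewrite -le_of_mulN ?yN//.
    by apply: ltW; apply: lt_le_trans xa _; rewrite !intD.
  apply: cell_mass_ge => // x /cx /andP[yx xx0]; first by rewrite /= in_itv /=; lra.
  by apply: incr => //; rewrite in_itv /=; lra.
- move=> a ma; have [Na|Na] := leP N%:Z a.
    by rewrite (@cell_mass_eq0 (a + 1)) ?cell_mass_ge0//; lia.
  have x0a : x0 * N%:R < a%:~R.
    by apply: lt_le_trans (floorD1_gt _) _; rewrite ler_int lezD1.
  have Na' : (a + 1)%:~R <= N%:Z%:~R :> R by rewrite ler_int; lia.
  rewrite NZ in Na'.
  have y1 : x0 <= y a <= 1.
    by move: Na'; rewrite intD => ?; apply/andP; split; rewrite -le_of_mulN yN intD; lra.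
  have yI : y a \in (`[x0, 1])%R by rewrite in_itv.
  have /andP[y0 _] : 0 <= f (y a) <= phi by apply: density_ge0; lra.
  apply: (@le_trans _ _ (f (y a) / N%:R)).
    apply: cell_mass_le => // x /cellP/andP[ax xa] /andP[x1 x2].
    have xy : y a <= x by rewrite -le_of_mulN yN.
    by apply: decr => //; rewrite in_itv /= x2 andbT; lra.
  have cx x : cell a x -> x0 <= x <= y a.
    move=> /cellP/andP[ax xa]; apply/andP; split; rewrite -le_of_mulN ?yN; last exact: ltW.
    exact/ltW/(lt_le_trans x0a).
  apply: cell_mass_ge => // x /cx /andP[yx xx0]; first by rewrite /= in_itv /=; lra.
  by apply: decr => //; rewrite in_itv /=; lra.
Qed.

Lemma preimage_outside_eq0 : P (X @^-1` (~` `[-1, 1])) = 0%E.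
Proof.
have -> : P (X @^-1` (~` `[-1, 1])) = distribution P X (~` `[-1, 1]) by [].
rewrite X_drawn; last exact: measurableC.
by rewrite setICl integral_set0.
Qed.

End Law.
End CellMass.

Lemma leq_expn2r (a b c : nat) : (a <= b)%N -> (a ^ c <= b ^ c)%N.
Proof. by move=> ab; case: c => // c; rewrite leq_exp2r. Qed.

Section Rounding.
Local Open Scope classical_set_scope.
Variables (R : realType) (d' n : nat).
Local Notation d := d'.+1.
Local Notation coords := ('I_d * 'I_n)%type.
Variables (S : {set cube n}) (W : cube n -> R) (N : nat).
Hypothesis N_gt0 : (0 < N)%N.

(** After scaling by [N], rounding moves the value of a solution by at most [n], so without near
    ties the rounded order implies the strict true order. A solution that is not strictly optimal
    after rounding is thus dominated before it. *)
Lemma PO_le_strict_pareto (V : 'M[R]_(d, n)) (u : {ffun coords -> int}) :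
  (forall k j, cell N (u (k, j)) (V k j)) -> ~~ near_tie u ->
  (PO S W V <= #|strict_pareto S W u|)%N.
Proof.
move=> uV ntie; have NR : 0 < N%:R :> R by rewrite ltr0n.
have key k (z x : cube n) : z != x -> lin u k z <= lin u k x ->
    \sum_j V k j * (z j)%:R < \sum_j V k j * (x j)%:R.
  move=> zx le.
  have gap : (2 * n)%:Z < lin u k x - lin u k z.
    move: ntie; apply: contraNlt => tie.
    apply/existsP; exists k; apply/existsP; exists x; apply/existsP; exists z.
    rewrite eq_sym zx /=; move: le tie; move: (lin u k x) (lin u k z) => a b; lia.
  have err (y : cube n) : `|(\sum_j V k j * (y j)%:R) * N%:R - (lin u k y)%:~R| <= n%:R :> R.
    rewrite /lin rmorph_sum /= mulr_suml -sumrB.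
    apply: le_trans (ler_norm_sum _ _ _) _.
    apply: (@le_trans _ _ (\sum_(j < n) 1)); last by rewrite sumr_const card_ord.
    apply: ler_sum => j _; have /(cellP N_gt0)/andP[] := uV k j.
    rewrite rmorphM /= rmorphD /= => l r; case: (y j); rewrite ?mulr1 ?mulr0 ?mul0r ?subrr ?normr0//.
    by rewrite ler_norml; apply/andP; split; lra.
  have : (2 * n)%:R < (lin u k x)%:~R - (lin u k z)%:~R :> R.
    by rewrite -rmorphB /= -[_%:R]/((2 * n)%:Z%:~R) ltr_int.
  rewrite natrM => gapR; have := err x; have := err z; rewrite !ler_norml.
  move=> /andP[_ ez] /andP[ex _].
  rewrite -(ltr_pM2r NR); lra.
apply/subset_leq_card/fintype.subsetP => x; rewrite !inE => /andP[xS nodom].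
rewrite xS /=; apply/forall_inP => z zS; apply/implyP => zx; apply/implyP => /forallP le.
rewrite ltNge; apply: contraNN nodom => Wzx.
apply/exists_inP; exists z => //; apply/andP; split.
  apply/forallP => t; rewrite /objective; case: unliftP => [k _|_] //.
  exact/ltW/key.
apply/existsP; exists (lift ord_max ord0); rewrite /objective liftK; exact: key.
Qed.

(* The value [N] is included because [1] lies in [cell N N]. *)
Definition box : seq {ffun coords -> int} :=
  [seq [ffun i => (f i : nat)%:Z - N%:Z] | f : {ffun coords -> 'I_(2 * N).+1}].

Lemma box_uniq : uniq box.
Proof.
rewrite map_inj_uniq ?enum_uniq// => f g /ffunP fg; apply/ffunP => i.
by apply: ord_inj; have := fg i; rewrite !ffunE => /addIr[].
Qed.

Lemma mem_box (u : {ffun coords -> int}) : (forall i, `|u i| <= N%:Z) -> u \in box.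
Proof.
move=> uN; apply/mapP; exists [ffun i => inord (absz (u i + N%:Z)%R)]; first by rewrite mem_enum.
by apply/ffunP => i; rewrite !ffunE inordK; have := uN i; move: (u i) => a; lia.
Qed.

Lemma box_le (u : {ffun coords -> int}) : u \in box -> forall i, `|u i| <= N%:Z.
Proof.
by case/mapP => f _ -> i; rewrite ffunE; have := ltn_ord (f i); move: (nat_of_ord (f i)) => a; lia.
Qed.

Lemma PO_le_exp2 (V : 'M[R]_(d, n)) : (PO S W V <= 2 ^ n)%N.
Proof.
by apply: leq_trans (max_card _) _; rewrite card_ffun card_ord card_bool.
Qed.

Variables (c : nat) (phi : R) (f : 'I_d -> 'I_n -> R -> R).
Context {disp : measure_display} {T : measurableType disp}.
Variables (P : probability T R) (V : 'I_d -> 'I_n -> {RV P >-> R}).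
Hypothesis phi_ge0 : 0 <= phi.
Hypothesis f_density : forall k j, smooth_density phi (f k j).
Hypothesis V_drawn : forall k j, drawn_from (V k j) (f k j).
Hypothesis V_indep : mutually_independent (fun i : coords => V i.1 i.2).

Let p (i : coords) := cell_mass N (V i.1 i.2).

(** The sample space is covered by the events fixing all cells and the null events of leaving
    [[-1, 1]]. Under a near tie the crude bound [(2 ^ n) ^ c] is used; the second hypothesis makes
    its contribution at most 1. *)
Lemma expectation_PO_le (G : R) :
  \sum_(u <- box) (\prod_i p i (u i)) * (#|strict_pareto S W u| ^ c)%:R <= G ->
  ((2 ^ n) ^ c * (d * (2 ^ n * (2 ^ n * (4 * n).+1))))%:R * (phi / N%:R) <= 1 ->
  ('E_P[(fun w => (PO S W (\matrix_(t, i) V t i w))%:R ^+ c)%R] <= (G + 1)%:E)%E.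
Proof.
move=> hG hN.
pose A (u : {ffun coords -> int}) := \bigcap_(i in [set` [set: coords]%SET])
  (V i.1 i.2 @^-1` cell N (u i)).
pose outside (i : coords) := V i.1 i.2 @^-1` (~` `[-1, 1] : set R).
have [all_coords [uall mall]] : exists s : seq coords, uniq s /\ forall i, i \in s.
  by exists (enum {: coords}); split=> [|i]; rewrite ?enum_uniq ?mem_enum.
pose coeff (e : {ffun coords -> int} + coords) : R := match e with
  | inl u => (#|strict_pareto S W u| ^ c)%:R + ((2 ^ n) ^ c)%:R * (near_tie u)%:R
  | inr i => ((2 ^ n) ^ c)%:R end.
pose ev (e : {ffun coords -> int} + coords) :=
  match e with inl u => A u | inr i => outside i end.
have mV i a : measurable (V i.1 i.2 @^-1` cell N a).
  by apply: measurable_preimage_cell.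
have mev e : measurable (ev e).
  case: e => [u|i] /=; last by apply: measurable_funPTI; exact: measurableC.
  by apply: fin_bigcap_measurable => // i _.
apply: (@le_trans _ _ (\sum_(e <- map inl box ++ map inr all_coords) (coeff e)%:E * P (ev e))%E).
  apply: expectation_le_sum => //.
  - by case=> [u|i] /=; rewrite ?addr_ge0.
  - move=> w; rewrite big_cat 2!big_map /=.
    have ge0 (e : {ffun coords -> int} + coords) : 0 <= coeff e * \1_(ev e) w.
      by case: e => [u|i]; rewrite /= mulr_ge0// addr_ge0.
    have POc : (PO S W (\matrix_(t, i) V t i w))%:R ^+ c <= ((2 ^ n) ^ c)%:R :> R.
      by rewrite -natrX ler_nat leq_expn2r// PO_le_exp2.
    have [[i wi]|inside] := pselect (exists i, outside i w).
      rewrite [leRHS]addrC (bigD1_seq i (mall i) uall)/=.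
      have -> : \1_(ev (inr i)) w = 1 :> R by rewrite indicE mem_set.
      rewrite mulr1 -addrA; apply: (@le_trans _ _ (coeff (inr i))) => //.
      by rewrite lerDl addr_ge0// sumr_ge0.
    pose u : {ffun coords -> int} := [ffun i => Num.floor (V i.1 i.2 w * N%:R)].
    have Vcell (q : coords) : cell N (u q) (V q.1 q.2 w).
      by rewrite ffunE; apply: mem_cell_floor.
    have ubox : u \in box.
      apply: mem_box => i; have := Vcell i => /(cellP N_gt0).
      have : (V i.1 i.2 w) \in (`[-1, 1])%R.
        by apply: contrapT => h; apply: inside; exists i.
      have NR : 0 < N%:R :> R by rewrite ltr0n.
      rewrite in_itv /= => /andP[v1 v2] /andP[l r].
      have : (u i)%:~R <= N%:Z%:~R :> R by apply: le_trans l _; rewrite -[leRHS]mul1r ler_pM2r.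
      have : (- N%:Z)%:~R < (u i + 1)%:~R :> R.
        by apply: le_lt_trans r; rewrite rmorphN -mulN1r ler_pM2r.
      by rewrite ler_int ltr_int; lia.
    rewrite (bigD1_seq u ubox box_uniq)/=.
    have -> : \1_(ev (inl u)) w = 1 :> R by rewrite indicE mem_set// => i _; apply: Vcell.
    rewrite mulr1 -addrA; apply: (@le_trans _ _ (coeff (inl u))).
      rewrite /coeff; case: (boolP (near_tie u)) => /= tie; rewrite ?mulr1 ?mulr0 ?addr0.
        by rewrite ler_wpDl.
      rewrite -natrX ler_nat leq_expn2r//; apply: PO_le_strict_pareto => // k j.
      by rewrite mxE; apply: (Vcell (k, j)).
    by rewrite lerDl addr_ge0// sumr_ge0.
rewrite big_cat 2!big_map /= [X in (_ + X)%E]big1 ?adde0; last first.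
  move=> i _; rewrite (preimage_outside_eq0 (V_drawn i.1 i.2)) ?mule0//.
have PA u : P (A u) = (\prod_i p i (u i))%:E.
  rewrite /A V_indep; last by move=> i _; apply: measurable_cell.
  rewrite -prodEFin; apply: eq_big => [i|i _]; first by rewrite finset.in_setT.
  by rewrite EFin_cell_mass.
under eq_bigr => u _ do rewrite PA -EFinM mulrC mulrDr mulrCA.
rewrite sumEFin lee_fin big_split/= lerD// -mulr_sumr.
apply: le_trans hN; rewrite natrM -mulrA ler_wpM2l//.
apply: sum_near_tie_le => //.
- by move=> i; apply: (cell_mass_submass N_gt0 (V i.1 i.2)).
- exact: box_uniq.
- exact: divr_ge0.
- by move=> i a; apply: (cell_mass_le_phi N_gt0 (f_density i.1 i.2) (V_drawn i.1 i.2)).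
Qed.

End Rounding.

(** The passage common to both density classes: [D] is the class, [Q] what its cell masses satisfy
    besides the bound [phi / N]. *)
Lemma smoothed_moment_le (R : realType) (d' c e : nat) (K : R)
    (D : R -> (R -> R) -> Prop) (Q : R -> nat -> (int -> R) -> Prop) :
  0 <= K -> (forall phi f, D phi f -> smooth_density phi f) ->
  (forall phi N f disp (T : measurableType disp) (P : probability T R)
     (X : {RV P >-> R}), (0 < N)%N -> D phi f -> drawn_from X f ->
     Q phi N (cell_mass N X)) ->
  (forall (n N : nat) (phi : R) (S : {set cube n}) (W : cube n -> R)
      (p : 'I_d'.+1 * 'I_n -> int -> R),
    (0 < n)%N -> (0 < N)%N -> 1 <= phi -> (c * d'.+1 <= n)%N ->
    (forall i, submass (p i)) -> (forall i, bounded_support (p i)) ->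
    (forall i a, p i a <= phi / N%:R) -> (forall i, Q phi N (p i)) ->
    \sum_(u <- box d' n N) (\prod_i p i (u i)) * (#|strict_pareto S W u| ^ c)%:R
      <= K * (n%:R ^+ (2 * d'.+1) * phi ^+ e) ^+ c) ->
  exists K' : R, forall (n : nat) (phi : R), (1 <= n)%N -> 1 <= phi ->
    (smoothed_moment (D phi) d'.+1 n c
      <= (K' * (n%:R ^+ (2 * d'.+1) * phi ^+ e) ^+ c)%:E)%E.
Proof.
move=> K0 Ddens DQ bound.
(* The 1 pays for near ties, the last summand for [n < c * d], where [2 ^ n] is below a constant. *)
exists (K + 1 + ((2 ^ (c * d'.+1)) ^ c)%:R) => n phi n1 phi1.
have phi0 : 0 <= phi by apply: le_trans phi1.
set B : R := _ ^+ c.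
have B1 : 1 <= B.
  by rewrite exprn_ege1// mulr_ege1// exprn_ege1// ler1n.
apply: ge_ereal_sup => _ [S [W [f [disp [T [P [V [Df Vf indep ->]]]]]]]].
have [cdn|ncd] := leqP (c * d'.+1) n; last first.
  apply: (@le_trans _ _ ((2 ^ (c * d'.+1)) ^ c)%:R%:E).
    have := @expectation_le_sum R disp T P
      (fun w => (PO S W (\matrix_(t, i) V t i w))%:R ^+ c) unit [:: tt]
      (fun=> ((2 ^ (c * d'.+1)) ^ c)%:R) (fun=> setT).
    rewrite big_seq1 probability_setT mule1; apply=> // w.
    rewrite big_seq1 indicT mulr1 -natrX ler_nat leq_expn2r//.
    apply: leq_trans (PO_le_exp2 _ _ _) _.
    by rewrite leq_exp2l// ltnW.
  rewrite lee_fin -[leLHS]mulr1; apply: ler_pM => //.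
  by rewrite lerDr addr_ge0.
pose M : R := ((2 ^ n) ^ c * (d'.+1 * (2 ^ n * (2 ^ n * (4 * n).+1))))%:R.
(* The mesh may depend on [n] and [phi], as the bound to be applied is free of [N]. *)
pose N := (Num.bound (M * phi)).+1.
have NR : 0 < N%:R :> R by rewrite ltr0n.
have hN : M * (phi / N%:R) <= 1.
  rewrite mulrA ler_pdivrMr// mul1r ltW// (lt_trans (archi_boundP _))//.
    by rewrite mulr_ge0.
  by rewrite ltr_nat.
have dens k j : smooth_density phi (f k j) by apply: Ddens.
have N0 : (0 < N)%N by [].
have hG := bound n N phi S W (fun i => cell_mass N (V i.1 i.2)) n1 N0 phi1 cdn.
apply: le_trans (expectation_PO_le N0 phi0 dens Vf indep (hG _ _ _ _) hN) _.
- by move=> i; apply: (cell_mass_submass N0 (V i.1 i.2)).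
- by move=> i; exists N => a; apply: (cell_mass_eq0 N0 (dens i.1 i.2) (Vf i.1 i.2)).
- by move=> i a; apply: (cell_mass_le_phi N0 (dens i.1 i.2) (Vf i.1 i.2)).
- by move=> i; exact: DQ (Df i.1 i.2) (Vf i.1 i.2).
rewrite lee_fin !mulrDl mul1r -addrA lerD2l.
by rewrite ler_wpDr// mulr_ge0// (le_trans ler01).
Qed.

Theorem theorem3 (R : realType) (d c : nat) (hd : (1 <= d)%N) :
  (exists K : R, forall (n : nat) (phi : R), (1 <= n)%N -> 1 <= phi ->
     (smoothed_moment (quasiconcave_smooth_density phi) d n c
        <= (K * (n%:R ^+ (2 * d) * phi ^+ d) ^+ c)%:E)%E) /\
  (exists K : R, forall (n : nat) (phi : R), (1 <= n)%N -> 1 <= phi ->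
     (smoothed_moment (smooth_density phi) d n c
        <= (K * (n%:R ^+ (2 * d) * phi ^+ (d * (d + 1))) ^+ c)%:E)%E).
Proof.
case: d hd => // d' _; split.
  apply: (@smoothed_moment_le R d' c d'.+1 _ _
    (fun phi N p => variation_le (4 * phi / N%:R) p)); last first.
  - move=> n N phi S W p n0 N0 phi1 cdn hp sp _ vp.
    apply: (@sum_strict_pareto_variation R d' n c S W p N phi) => //.
    + exact: lt_le_trans phi1.
    + exact: box_uniq.
    + exact: box_le.
  - by move=> phi N f disp T P X N0 [dens qc] Xf; apply: cell_mass_variation Xf _.
  - by move=> phi f [].
  - by rewrite mulr_ge0// exprn_ge0// mulr_ge0.
apply: (@smoothed_moment_le R d' c _ _ _ (fun _ _ _ => True)); last first.
- move=> n N phi S W p n0 N0 phi1 cdn hp _ pM _.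
  apply: (@sum_strict_pareto_general R d' n c S W p N phi) => //.
  + exact: box_uniq.
  + exact: box_le.
- by [].
- by [].
- by rewrite !mulr_ge0// exprn_ge0.
Qed.
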